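(* Consider the nearly unstable heavy-tailed Hawkes processes started empty at time $0$ with parameters $(\mu_T,\rho_T)$ given by $1-\rho_T=\lambda^*T^{-\gamma}$, $\mu_T=\mu^*T^{\gamma-1}$. Assume that there are $[0,\infty)$-valued random variables $V_\infty(u)$ such that $V_T(u)=\lambda_T(uT)/\bar\lambda_T$ converges in law to $V_\infty(u)$ as $T\to\infty$ for almost every $u\in(0,1]$, and that $\int_0^1\mathbb P(V_\infty(u)=0)\,\mathrm du>0$. Then $A_T\to\infty$ and $\mathcal J^{\rm eff}_{\log\mu,T}\to\infty$ as $T\to\infty$, while $\mathcal J^{\rm eff}_{\log(1-\rho),T}\le\mu^*\lambda^*/\rho_T^2$.
   Context: Fix $\gamma\in(1/2,1)$, $\lambda^*,\mu^*>0$ and $g(t)=\gamma(1+t)^{-1-\gamma}$, $t\ge0$. For $T$ large enough that $\lambda^*T^{-\gamma}<1$, let $\rho_T=1-\lambda^*T^{-\gamma}$, $\mu_T=\mu^*T^{\gamma-1}$, $\bar\lambda_T=\mu_T/(1-\rho_T)$. $N$ is the linear Hawkes process started empty at time $0$: a simple point process on $(0,\infty)$ with stochastic intensity $\lambda_T(t)=\mu_T+\rho_T\int_{(0,t)}g(t-s)\,N(\mathrm ds)$. Put $A_T=\frac1T\mathbb E\int_0^T\frac{\bar\lambda_T}{\lambda_T(t)}\,\mathrm dt$. The Fisher information matrix $\mathcal J$ of $(\theta,\eta)=(\log\mu,\log(1-\rho))$ on $[0,T]$ (kernel shape $g$ known) is the covariance matrix of the score of the log-likelihood $\int_{(0,T]}\log\lambda\,\mathrm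 dN-\int_0^T\lambda\,\mathrm dt$ at the true parameter, i.e. $\mathbb E\int_0^T(\nabla\lambda)(\nabla\lambda)^\top\lambda^{-1}\,\mathrm dt$, and the efficient informations are $\mathcal J^{\rm eff}_{\log\mu,T}=\mathcal J_{\theta\theta}-\mathcal J_{\theta\eta}^2/\mathcal J_{\eta\eta}$ and $\mathcal J^{\rm eff}_{\log(1-\rho),T}=\mathcal J_{\eta\eta}-\mathcal J_{\theta\eta}^2/\mathcal J_{\theta\theta}$. *)

(* Defs.v *)
From HB Require Import structures.
From mathcomp Require Import all_boot all_order all_algebra.
From mathcomp Require Import all_classical all_reals all_analysis measurable_realfun.

Set Implicit Arguments.
Unset Strict Implicit.
Unset Printing Implicit Defensive.

Import Order.TTheory GRing.Theory Num.Theory.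
Import numFieldNormedType.Exports.

Local Open Scope classical_set_scope.
Local Open Scope ring_scope.

(* A point process on (0, +oo) is encoded as its random counting measure, i.e.
   a kernel from the probability space to the Borel sets of R that does not
   charge ]-oo, 0]. *)
Definition simple_point_process d (Om : measurableType d) (R : realType)
    (P : probability Om R) (N : R.-ker Om ~> measurableTypeR R) : Prop :=
  [/\ forall w, N w [set` `]-oo, (0 : R)]] = 0%E,
      forall w (t : R) (B : set R), measurable B -> B `<=` `]0, t] ->
        exists n : nat, N w B = n%:R%:E
    & {ae P, forall w, forall t : R, (N w [set t] <= 1)%E}].

(* F_t = sigma (N(B) : B Borel, B included in ]0, t]) *)
Definition history d (Om : measurableType d) (R : realType)
    (N : R.-ker Om ~> measurableTypeR R) (t : R) : set (set Om) :=
  <<s [set A | exists (B : set R) (C : set (\bar R)),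
         [/\ measurable B, B `<=` `]0, t], measurable C
           & A = (fun w => N w B) @^-1` C]] >>.

(* The predictable sigma-algebra on ]0, +oo[ x Om of the history of N. *)
Definition predictable_sigma d (Om : measurableType d) (R : realType)
    (N : R.-ker Om ~> measurableTypeR R) : set (set (R * Om)) :=
  <<s `]0, +oo[ `*` [set: Om],
      [set E | exists (s t : R) (A : set Om),
         [/\ 0 <= s, s <= t, history N s A & E = `]s, t] `*` A]] >>.

Definition predictable d (Om : measurableType d) (R : realType)
    (N : R.-ker Om ~> measurableTypeR R) (C : R -> Om -> R) : Prop :=
  forall B : set R, measurable B ->
    predictable_sigma N ((`]0, +oo[ `*` [set: Om]) `&`
                         (fun p => C p.1 p.2) @^-1` B).

(* N admits the predictable intensity lam with respect to its own history. *)
Definition has_intensity d (Om : measurableType d) (R : realType)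
    (P : probability Om R) (N : R.-ker Om ~> measurableTypeR R)
    (lam : R -> Om -> R) : Prop :=
  [/\ predictable N lam,
      forall (t : R) w, 0 < t -> 0 <= lam t w
    & forall C : R -> Om -> R, predictable N C -> (forall t w, 0 <= C t w) ->
      (\int[P]_w \int[N w]_(t in `]0%R, +oo[) (C t w)%:E =
       \int[P]_w \int[lebesgue_measure]_(t in `]0%R, +oo[)
         (C t w * lam t w)%:E)%E].

Definition hawkes_intensity (R : realType) (g : R -> R) (mu rho : R)
    (n : {measure set (measurableTypeR R) -> \bar R}) (t : R) : R :=
  mu + rho * \int[n]_(s in `]0, t[) g (t - s).

Definition hawkes_process d (Om : measurableType d) (R : realType)
    (P : probability Om R) (g : R -> R) (mu rho : R)
    (N : R.-ker Om ~> measurableTypeR R) : Prop :=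
  simple_point_process P N /\
  has_intensity P N (fun t w => hawkes_intensity g mu rho (N w) t).

(* The intensity as a function of theta = log mu and eta = log (1 - rho),
   the point configuration n being fixed. *)
Definition log_intensity (R : realType) (g : R -> R) (theta eta : R)
    (n : {measure set (measurableTypeR R) -> \bar R}) (t : R) : R :=
  hawkes_intensity g (expR theta) (1 - expR eta) n t.

(* Index 0 is the derivative in theta, index 1 the derivative in eta. *)
Definition grad_intensity (R : realType) (g : R -> R) (theta eta : R)
    (n : {measure set (measurableTypeR R) -> \bar R}) (t : R) : 'cV[R]_2 :=
  \col_(i < 2)
    if i == 0 then derive1 (fun x => log_intensity g x eta n t) theta
    else derive1 (fun y => log_intensity g theta y n t) eta.

(* The matrix E int_0^T (grad lam) (grad lam)^T / lam dt at the true parameter;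
   its entries are finite because lam >= mu > 0 and E lam is bounded on [0, T],
   so taking [fine] loses nothing. *)
Definition fisher_information d (Om : measurableType d) (R : realType)
    (P : probability Om R) (g : R -> R) (mu rho : R)
    (N : R.-ker Om ~> measurableTypeR R) (T : R) : 'M[R]_2 :=
  \matrix_(i < 2, j < 2)
    fine (\int[P]_w \int[lebesgue_measure]_(t in `[0%R, T])
      (let D := grad_intensity g (ln mu) (ln (1 - rho)) (N w) t in
       (D *m D^T) i j / hawkes_intensity g mu rho (N w) t)%:E)%E.

Definition efficient_log_mu (R : realType) (J : 'M[R]_2) : R :=
  J 0 0 - J 0 1 ^+ 2 / J 1 1.

Definition efficient_log_one_minus_rho (R : realType) (J : 'M[R]_2) : R :=
  J 1 1 - J 0 1 ^+ 2 / J 0 0.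

(* Convergence in law as T -> +oo of random variables X T, each on its own
   probability space, to Y. *)
Definition cvg_in_law (R : realType) (d : R -> measure_display)
    (Om : forall T, measurableType (d T)) (P : forall T, probability (Om T) R)
    (X : forall T, Om T -> R)
    (d' : measure_display) (Om' : measurableType d') (Q : probability Om' R)
    (Y : Om' -> R) : Prop :=
  forall f : R -> R, continuous f -> (exists M : R, forall x : R, `|f x| <= M) ->
    (\int[P T]_w (f (X T w))%:E)%E @[T --> +oo%R] -->
    (\int[Q]_w (f (Y w))%:E)%E.

Definition heavy_kernel (R : realType) (gamma t : R) : R :=
  gamma * (1 + t) `^ (- 1 - gamma).

Definition rho_ (R : realType) (gamma lam_star T : R) : R :=
  1 - lam_star * T `^ (- gamma).

Definition mu_ (R : realType) (gamma mu_star T : R) : R :=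
  mu_star * T `^ (gamma - 1).

Definition lambda_bar (R : realType) (gamma lam_star mu_star T : R) : R :=
  mu_ gamma mu_star T / (1 - rho_ gamma lam_star T).

Definition lambda_ (R : realType) (gamma lam_star mu_star : R) (T : R)
    (n : {measure set (measurableTypeR R) -> \bar R}) (t : R) : R :=
  hawkes_intensity (heavy_kernel gamma) (mu_ gamma mu_star T)
    (rho_ gamma lam_star T) n t.

Definition A_ d (Om : measurableType d) (R : realType) (P : probability Om R)
    (gamma lam_star mu_star T : R) (N : R.-ker Om ~> measurableTypeR R) :
    \bar R :=
  (T^-1%:E * \int[P]_w \int[lebesgue_measure]_(t in `[0%R, T])
    (lambda_bar gamma lam_star mu_star T
       / lambda_ gamma lam_star mu_star T (N w) t)%:E)%E.

Definition fisher_ d (Om : measurableType d) (R : realType)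
    (P : probability Om R) (gamma lam_star mu_star T : R)
    (N : R.-ker Om ~> measurableTypeR R) : 'M[R]_2 :=
  fisher_information P (heavy_kernel gamma) (mu_ gamma mu_star T)
    (rho_ gamma lam_star T) N T.

(* Main.v *)
Require Import Defs.
From HB Require Import structures.
From mathcomp Require Import all_boot all_order all_algebra.
From mathcomp Require Import all_classical all_reals all_analysis measurable_realfun.
From mathcomp Require Import ring lra.
Set Implicit Arguments.
Unset Strict Implicit.
Unset Printing Implicit Defensive.

Import Order.TTheory GRing.Theory Num.Theory.
Import numFieldNormedType.Exports.
Local Open Scope classical_set_scope.
Local Open Scope ring_scope.

(** Write the intensity as lambda = mu + rho * Phi, where Phi t is the
    integral of g (t - s) over the points s < t, and put
    L = E int_0^T lambda dt and a = E int_0^T (1 / lambda) dt.  The gradient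
    has components d lambda / d theta = mu and d lambda / d eta =
    - (1 - rho) * Phi, and Phi = (lambda - mu) / rho, so every entry of the Fisher matrix J is an
    expectation of a function of lambda alone.

    Efficient information for log (1 - rho).  It is at most J_11, and
    (lambda - mu)^2 / lambda <= lambda gives J_11 <= ((1 - rho) / rho)^2 * L
    (fisher11_le).  The branching structure bounds the mean number of points:
    L <= mu * T / (1 - rho) (expected_intensity_le).  The product of the two is
    mu_star * lam_star / rho^2.

    Divergence of A_T.  After the change of time t = u T, A_T is the integral
    over u in ]0, 1] of E [1 / V_T u].  Replacing 1 / v by the bounded
    continuous minorant 1 / (|v| + e), convergence in law followed by Fatou's
    lemma in u shows that liminf A_T >= e^-1 * int_0^1 Q_u (V u = 0) du, for
    every e > 0 (expected_inverse_diverges).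

    Efficient information for log mu.  First, J_00 = mu^2 * a is exactly
    mu_star * lam_star * A_T (fisher_log_muE), hence diverges.  The subtracted
    term J_01^2 / J_11 stays bounded: |J_01| <= (1 - rho) * mu * T / rho, and
    (lambda - mu)^2 / lambda >= lambda - 2 mu gives
    J_11 >= ((1 - rho) / rho)^2 * (L - 2 mu T), so the loss is at most
    (mu T)^2 / (L - 2 mu T) with mu T = mu_star * T^gamma.  It remains to
    see that L >= c * T^(2 gamma) (expected_count_ge).  Testing the renewal
    equation of the mean intensity against T - t gives
    mu T^2 / 2 <= ((1 - rho) T + K) * L, where K bounds the
    integrated tail int_0^T (1 + x)^(-gamma) dx of the kernel
    (expected_intensity_ge); both 1 - rho = lam_star * T^(-gamma) and
    K / T are of order T^(-gamma), whence the claim. *)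

(** * Monotone integration without measurability *)

Section lower_integral.
Import HBNNSimple.

(** The integral of a non-negative function is a supremum over the simple
    functions below it, so it is monotone on arbitrary functions.  This is what
    allows comparing expectations of integrals against the random measure N, and
    integrals in u of Q_u (V u = 0), as if they were lower integrals. *)
Lemma ge0_le_integral_lower d (X : measurableType d) (R : realType)
    (m : {measure set X -> \bar R}) (D : set X) (f1 f2 : X -> \bar R) :
  (forall x, D x -> (0 <= f1 x)%E) -> (forall x, D x -> (f1 x <= f2 x)%E) ->
  (\int[m]_(x in D) f1 x <= \int[m]_(x in D) f2 x)%E.
Proof.
move=> f10 f12; rewrite !(integral_mkcond D).
rewrite !ge0_integralTE; last 2 first.
- by apply: erestrict_ge0 => x Dx; rewrite (le_trans (f10 _ Dx))// f12.
- exact: erestrict_ge0.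
apply: ge_ereal_sup => _ [h /= hf1 <-]; apply: ereal_sup_ubound.
by exists h => //= x; rewrite (le_trans (hf1 x))// lee_restrict.
Qed.

(** Extracts from a positive integral of an arbitrary function a measurable
    minorant to which Fatou's lemma and almost everywhere comparison apply. *)
Lemma integral_lower_witness d (X : measurableType d) (R : realType)
    (m : {measure set X -> \bar R}) (D : set X) (f : X -> \bar R) :
  (forall x, D x -> (0 <= f x)%E) -> (0 < \int[m]_(x in D) f x)%E ->
  exists h : X -> \bar R, [/\ measurable_fun setT h, forall x, (0 <= h x)%E,
    forall x, D x -> (h x <= f x)%E & (0 < \int[m]_(x in D) h x)%E].
Proof.
move=> f0; rewrite (integral_mkcond D) ge0_integralTE; last first.
  exact: erestrict_ge0.
move=> /ereal_sup_gt[_ [h /= hf <-] h0].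
exists (EFin \o h); split.
- exact/measurable_EFinP.
- by move=> x; rewrite /= lee_fin fun_ge0.
- by move=> x Dx; rewrite (le_trans (hf x))// patchE mem_set.
- suff -> : (\int[m]_(x in D) (EFin \o h) x = sintegral m h)%E by [].
  rewrite integral_mkcond -integralT_nnsfun.
  apply: eq_integral => x _; rewrite patchE; case: ifPn => // /negP xD.
  have := hf x; rewrite patchE ifN; last exact/negP.
  rewrite lee_fin => hx0; apply/esym; congr EFin; apply/eqP.
  by rewrite eq_le hx0 fun_ge0.
Qed.

End lower_integral.

(** * Tonelli's theorem on a time strip, and dilation of time *)

Section slab.
Context d (Om : measurableType d) (R : realType) (P : probability Om R).
Variables (D : set R) (mD : measurable D) (f : R * Om -> \bar R).
Hypothesis mf : measurable_fun (D `*` [set: Om]) f.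
Hypothesis f0 : forall p, (D `*` [set: Om]) p -> (0 <= f p)%E.

(* Intensities are only known to be jointly measurable for positive times, so
   f is extended by zero before Tonelli's theorem is applied. *)
Let fD := f \_ (D `*` [set: Om]).

Let mfD : measurable_fun [set: measurableTypeR R * Om] fD.
Proof. by apply/(measurable_restrictT _ _).1 => //; exact: measurableX. Qed.

Let fD0 p : (0 <= fD p)%E.
Proof. exact: erestrict_ge0. Qed.

Let fDE t w : fD (t, w) = ((fun s => f (s, w)) \_ D) t.
Proof.
rewrite /fD !patchE; congr (if _ then _ else _).
by apply/idP/idP; rewrite !inE /=; [case|].
Qed.

Lemma slab_measurable_path w : measurable_fun D (fun t => f (t, w)).
Proof.
apply/(measurable_restrictT _ _).2 => //.
apply: (eq_measurable_fun (fun t => fD (t, w))) => [t _|]; first exact: fDE.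
exact: measurableT_comp mfD (measurable_pair2 w).
Qed.

Lemma slab_measurable_integral :
  measurable_fun [set: Om] (fun w => \int[lebesgue_measure]_(t in D) f (t, w))%E.
Proof.
have := measurable_fun_fubini_tonelli_G (m1 := lebesgue_measure) _ mfD fD0.
apply: eq_measurable_fun => w _; rewrite /fubini_G [RHS]integral_mkcond.
by apply: eq_integral => t _; exact: fDE.
Qed.

Let slab_restrict t : (\int[P]_w fD (t, w))%E =
  ((fun s => \int[P]_w f (s, w)) \_ D)%E t.
Proof.
rewrite [RHS]patchE; case: ifPn => tD.
  by apply: eq_integral => w _; rewrite fDE patchE tD.
by apply: integral0_eq => w _; rewrite fDE patchE (negbTE tD).
Qed.

Lemma slab_measurable_expectation :
  measurable_fun D (fun t => \int[P]_w f (t, w))%E.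
Proof.
apply/(measurable_restrictT _ _).2 => //.
have := measurable_fun_fubini_tonelli_F (m2 := P) _ mfD fD0.
by apply: eq_measurable_fun => t _; rewrite /fubini_F slab_restrict.
Qed.

Lemma slab_fubini_tonelli :
  (\int[P]_w \int[lebesgue_measure]_(t in D) f (t, w) =
   \int[lebesgue_measure]_(t in D) \int[P]_w f (t, w))%E.
Proof.
rewrite [RHS]integral_mkcond.
under [RHS]eq_integral do rewrite -slab_restrict.
rewrite (fubini_tonelli (m1 := lebesgue_measure) (m2 := P) _ mfD fD0).
apply: eq_integral => w _; rewrite integral_mkcond.
by apply: eq_integral => t _; rewrite fDE.
Qed.

End slab.

Section dilation.
Context (R : realType) (a : R).
Hypothesis a0 : 0 < a.

Let dil : measurableTypeR R -> measurableTypeR R := fun x => x * a.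

Let mdil : measurable_fun [set: measurableTypeR R] dil.
Proof. exact: measurable_funM. Qed.

Let dil_meas : {measure set (measurableTypeR R) -> \bar R} :=
  mscale (NngNum (ltW a0))
    (measure_function_pushforward__canonical__measure_function_Measure
       lebesgue_measure mdil).

Let lebesgue_measure_dil (A : set (measurableTypeR R)) : measurable A ->
  lebesgue_measure A = dil_meas A.
Proof.
apply: (@lebesgue_measure_unique R dil_meas) => // _ [[x y]] _ <-.
rewrite /dil_meas/= /mscale/= /pushforward.
rewrite (_ : dil @^-1` _ = `]x / a, y / a]%classic); last first.
  apply/seteqP; split => z /=; rewrite !in_itv/= /dil.
    by rewrite ltr_pdivrMr// ler_pdivlMr.
  by rewrite ltr_pdivrMr// ler_pdivlMr.
rewrite !lebesgue_measure_itv/= !lte_fin ltr_pM2r ?invr_gt0//.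
case: ifPn => _; last by rewrite mule0.
by rewrite -!EFinB -EFinM; congr EFin; field; rewrite gt_eqF.
Qed.

(** Lebesgue measure is a times its own image under u |-> u * a, by uniqueness
    on half-open intervals; this is the change of time t = u T. *)
Lemma ge0_integral_dilation (f : R -> \bar R) :
  measurable_fun `]0, a] f -> (forall t, 0 < t <= a -> (0 <= f t)%E) ->
  (\int[lebesgue_measure]_(t in `]0%R, a]) f t =
   a%:E * \int[lebesgue_measure]_(u in `]0%R, 1%R]) f (u * a)%R)%E.
Proof.
move=> mf f0.
rewrite (eq_measure_integral dil_meas) => [|A mA _]; last first.
  exact: lebesgue_measure_dil.
rewrite ge0_integral_mscale; last 3 first.
- exact: measurable_itv.
- exact: mf.
- by move=> t /=; rewrite in_itv/=; exact: f0.
congr (_ * _)%E.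
rewrite (ge0_integral_pushforward mdil) ?measurable_itv//; last first.
  by move=> t; rewrite inE/= in_itv/=; exact: f0.
rewrite [X in integral _ X](_ : _ = `]0, 1]%classic)//.
apply/seteqP; split => z /=; rewrite !in_itv/= /dil.
  by rewrite pmulr_lgt0// ger_pMl.
by rewrite pmulr_lgt0// ger_pMl.
Qed.

End dilation.

(** * The heavy-tailed kernel *)

Lemma integral_derivative (R : realType) (F f : R -> R) (a b : R) : a <= b ->
  (forall t, a <= t <= b -> is_derive t 1 F (f t)) ->
  (forall t, a <= t <= b -> {for t, continuous f}) ->
  (\int[lebesgue_measure]_(t in `]a, b]) (f t)%:E = (F b - F a)%:E)%E.
Proof.
move=> + dF cf; rewrite le_eqVlt => /predU1P[<-|ab].
  by rewrite set_itv_ge ?bnd_simp// integral_set0 subrr.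
have cF t : a <= t <= b -> {for t, continuous F}.
  move=> /dF h; apply: differentiable_continuous; apply/derivable1_diffP.
  exact: ex_derive.
have wf : {within `[a, b], continuous f}.
  apply: continuous_in_subspaceT => t /set_mem/=; rewrite in_itv/=.
  exact: cf.
rewrite integral_itv_obnd_cbnd; last first.
  apply/measurable_EFinP; apply: (@measurable_funS _ _ _ _ `[a, b]%classic) => //.
    exact: subset_itv_oc_cc.
  exact: subspace_continuous_measurable_fun.
rewrite (@continuous_FTC2 _ _ F _ _ ab wf) ?EFinB//.
- split.
  + move=> t /[!in_itv]/= /andP[at_ tb]; apply: (@ex_derive _ _ _ _ _ _ _ (dF t _)).
    by rewrite !ltW.
  + by apply: cvg_at_right_filter; apply: cF; rewrite lexx ltW.
  + by apply: cvg_at_left_filter; apply: cF; rewrite lexx ltW.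
- move=> t /[!in_itv]/= /andP[at_ tb]; rewrite derive1E.
  by apply: (@derive_val _ _ _ _ _ _ _ (dF t _)); rewrite !ltW.
Qed.

Section heavy_kernel.
Context (R : realType) (gamma : R).
Hypothesis gamma01 : 0 < gamma < 1.

Let gamma0 : 0 < gamma. Proof. by case/andP: gamma01. Qed.
Let gamma1 : gamma < 1. Proof. by case/andP: gamma01. Qed.

Lemma heavy_kernel_ge0 t : 0 <= heavy_kernel gamma t.
Proof. by rewrite mulr_ge0 ?powR_ge0 ?ltW. Qed.

Lemma heavy_kernel_le t : 0 <= t -> heavy_kernel gamma t <= gamma.
Proof.
move=> t0; rewrite /heavy_kernel ger_pMr//.
have t1 : 1 <= 1 + t by rewrite lerDl.
by rewrite -[leRHS](@powRr0 _ (1 + t)) ler_powR//; move: gamma0; lra.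
Qed.

Lemma measurable_heavy_kernel : measurable_fun [set: R] (heavy_kernel gamma).
Proof.
apply: measurable_funM => //.
apply: (measurableT_comp (measurable_powR (R := R) (- 1 - gamma))).
exact: measurable_funD.
Qed.

Let is_derive_shift_powR (a s t : R) : s <= t ->
  is_derive t 1 (fun u => (1 + (u - s)) `^ a) (a * (1 + (t - s)) `^ (a - 1)).
Proof.
move=> st.
have h0 : 0 < 1 + (t - s) by rewrite ltr_wpDr// subr_ge0.
have h1 := is_derive1_powR a h0.
have h2 : is_derive t 1 (fun u => 1 + (u - s)) 1.
  have := is_deriveD (is_derive_cst (1 : R) t 1)
    (is_deriveB (is_derive_id t 1) (is_derive_cst s t 1)).
  by rewrite subr0 add0r.
by have := @is_derive1_comp R (fun x => x `^ a) (fun u => 1 + (u - s)) t _ _ h1 h2;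
  rewrite mulr1.
Qed.

Let continuous_shift_kernel (s t : R) : s <= t ->
  {for t, continuous (fun u => heavy_kernel gamma (u - s))}.
Proof.
move=> st; apply: continuousM; first exact: cvg_cst.
apply: differentiable_continuous; apply/derivable1_diffP.
exact: (@ex_derive _ _ _ _ _ _ _ (is_derive_shift_powR (- 1 - gamma) st)).
Qed.

Lemma integral_heavy_kernel_le1 (s T : R) : s <= T ->
  (\int[lebesgue_measure]_(t in `]s, T]) (heavy_kernel gamma (t - s))%:E
   <= 1)%E.
Proof.
move=> sT; pose F t := - (1 + (t - s)) `^ (- gamma).
have dF t : s <= t <= T -> is_derive t 1 F (heavy_kernel gamma (t - s)).
  move=> /andP[st _].
  have := is_deriveN (is_derive_shift_powR (- gamma) st).
  by rewrite mulNr opprK [- gamma - 1]addrC.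
have cg t : s <= t <= T -> {for t, continuous (fun u => heavy_kernel gamma (u - s))}.
  by move=> /andP[st _]; exact: continuous_shift_kernel.
rewrite (integral_derivative sT dF cg).
by rewrite lee_fin /F subrr addr0 powR1 opprK gerDr oppr_le0 powR_ge0.
Qed.

(** The function F of the proof is an antiderivative of
    (T - t) * g (t - s).  The kernel has mass 1, so the integral would be T - s
    if that mass were concentrated at 0; spreading it out costs the integral
    over [0, T - s] of the tail (1 + x)^(-gamma), which grows like
    (T - s)^(1 - gamma). *)
Lemma integral_heavy_kernel_linear_ge (s T : R) : s <= T ->
  ((T - s - (1 + (T - s)) `^ (1 - gamma) / (1 - gamma))%:E <=
   \int[lebesgue_measure]_(t in `]s, T])
     ((T - t) * heavy_kernel gamma (t - s))%:E)%E.
Proof.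
move=> sT.
pose F t := - (T - t) * (1 + (t - s)) `^ (- gamma)
            - (1 - gamma)^-1 * (1 + (t - s)) `^ (1 - gamma).
have g1 : 0 < 1 - gamma by rewrite subr_gt0.
have dF t : s <= t <= T ->
    is_derive t 1 F ((T - t) * heavy_kernel gamma (t - s)).
  move=> /andP[st _].
  have h0 : 0 < 1 + (t - s) by rewrite ltr_wpDr// subr_ge0.
  have h1 := is_derive_shift_powR (- gamma) st.
  have h2 := is_derive_shift_powR (1 - gamma) st.
  have h3 : is_derive t 1 (fun u => - (T - u)) 1.
    have := is_deriveN (is_deriveB (is_derive_cst T t 1) (is_derive_id t 1)).
    by rewrite sub0r opprK.
  have h4 := is_deriveB (is_deriveM h3 h1) (is_deriveZ (1 - gamma)^-1 h2).
  apply: DeriveDef; first exact: (@ex_derive _ _ _ _ _ _ _ h4).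
  rewrite (@derive_val _ _ _ _ _ _ _ h4) /= {h4}.
  rewrite /heavy_kernel /GRing.scale/=.
  rewrite (_ : 1 - gamma - 1 = - gamma); last by ring.
  by rewrite [- gamma - 1]addrC; field; rewrite gt_eqF.
have cg t : s <= t <= T ->
    {for t, continuous (fun u => (T - u) * heavy_kernel gamma (u - s))}.
  move=> /andP[st _]; apply: continuousM; last exact: continuous_shift_kernel.
  by apply: continuousB; [exact: cvg_cst|exact: cvg_id].
rewrite (integral_derivative sT dF cg).
rewrite lee_fin /F !subrr addr0 !powR1 oppr0 mul0r sub0r !mulr1.
rewrite mulrC opprB opprD opprK.
suff : 0 <= (1 - gamma)^-1 by lra.
by rewrite invr_ge0 ltW.
Qed.

End heavy_kernel.

(** * Predictable processes of the history of N *)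

Section predictability.
Context d (Om : measurableType d) (R : realType).
Variable N : R.-ker Om ~> measurableTypeR R.

Lemma history_measurable t (A : set Om) : history N t A -> measurable A.
Proof.
apply: smallest_sub; first exact: sigma_algebra_measurable.
move=> _ [B [C [mB _ mC ->]]]; rewrite -[X in measurable X]setTI.
exact: (measurable_kernel N B mB).
Qed.

(** The history is generated by counts N w B, which are measurable in w, so every
    generating rectangle is measurable in the product.  This makes predictable
    processes, and the intensity in particular, jointly measurable. *)
Lemma predictable_sigma_measurable (E : set (R * Om)) :
  predictable_sigma N E -> measurable E.
Proof.
apply: smallest_sub.
  split; first exact: measurable0.
    move=> A mA; apply: measurableD => //.
    exact: measurableX.
  by move=> F mF; exact: bigcupT_measurable.
move=> _ [s [t [A [_ _ /history_measurable mA ->]]]].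
exact: measurableX.
Qed.

Lemma predictable_measurable_fun (C : R -> Om -> R) : predictable N C ->
  measurable_fun (`](0 : R), +oo[ `*` [set: Om]) (fun p : R * Om => C p.1 p.2).
Proof. move=> pC _ B mB; exact: (predictable_sigma_measurable (pC B mB)). Qed.

Let historyT t : history N t [set: Om].
Proof. by rewrite -setC0; apply: sigma_algebraC; exact: sigma_algebra0. Qed.

Let predictable_sigma_ray s A : 0 <= s -> history N s A ->
  predictable_sigma N (`]s, +oo[ `*` A).
Proof.
move=> s0 hA.
rewrite (_ : _ `*` _ = \bigcup_k (`]s, s + k%:R] `*` A)); last first.
  rewrite itv_bndy_bigcup_BRight; apply/seteqP; split.
    by move=> [t w] [[k _ tk] Aw]; exists k.
  by move=> [t w] [k _ [tk Aw]]; split => //; exists k.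
apply: sigma_algebra_bigcup => k; apply: sub_sigma_algebra.
by exists s, (s + k%:R), A; split => //; rewrite lerDl.
Qed.

Let predictable_sigmaU E F : predictable_sigma N E -> predictable_sigma N F ->
  predictable_sigma N (E `|` F).
Proof.
move=> hE hF; rewrite -bigcup2E; apply: sigma_algebra_bigcup => -[|[|k]] //.
exact: sigma_algebra0.
Qed.

(** The Borel sets E for which the strip E x Om is predictable form a
    sigma-algebra containing the intervals ]a, b]. *)
Lemma predictable_deterministic (c : R -> R) : measurable_fun [set: R] c ->
  predictable N (fun t _ => c t).
Proof.
move=> mc B mB.
pose E := c @^-1` B.
have mE : measurable E by rewrite -[X in measurable X]setTI; exact: mc.
pose G := [set E : set R | predictable_sigma N ((`]0, +oo[ `&` E) `*` [set: Om])].
have sG : sigma_algebra setT G.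
  split.
  - by rewrite /G/= setI0 set0X; exact: sigma_algebra0.
  - move=> F; rewrite /G/= => /sigma_algebraCD; congr (predictable_sigma N).
    apply/seteqP; split => -[t w] /=.
      by move=> [[t0 _] nF]; split => //; split => //; split => // Ft; exact: nF.
    by move=> [[t0 [_ nF]] _]; split => // -[[_ /nF]].
  - move=> F GF; rewrite /G/= setI_bigcupr setX_bigcupl.
    exact: sigma_algebra_bigcup.
have : G E.
  have : <<s ocitv (R := R)>> E by exact: mE.
  apply: smallest_sub => // _ [[a b] _ <-]; rewrite /G/=.
  have [ab|ab] := leP (Num.max a 0) b; last first.
    rewrite (_ : _ `&` _ = set0) ?set0X; first exact: sigma_algebra0.
    rewrite -subset0 => t /=; rewrite !in_itv/= andbT => -[t0 /andP[at_ tb]].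
    by move: ab; rewrite ltNge ge_max (le_trans (ltW t0) tb) (le_trans (ltW at_) tb).
  rewrite (_ : _ `&` _ = `]Num.max a 0, b]%classic); last first.
    apply/seteqP; split => t /=; rewrite !in_itv/= andbT gt_max.
      by move=> [-> /andP[-> ->]].
    by move=> /andP[/andP[-> ->] ->].
  apply: sub_sigma_algebra; exists (Num.max a 0), b, setT; split => //.
    by rewrite le_max lexx orbT.
rewrite /G/=; congr (predictable_sigma N).
by apply/seteqP; split => -[t w] /= [[]].
Qed.

(* An enumeration of the non-negative rationals; max and the default 0 make it
   total on nat. *)
Let time_rat (i : nat) : R :=
  if unpickle i is Some q then Num.max (ratr (q : rat)) 0 else 0.

(** For t > 0 and integer counts this is, by continuity from below, the event that
    fewer than n points precede t.  Testing only closed counts at rational times makes its complement a countable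
    union of predictable rectangles ]q, +oo[ x {N ]0, q] >= n}. *)
Definition early (n : nat) (t : R) (w : Om) : Prop :=
  forall i, time_rat i < t -> (N w `]0%R, time_rat i]%classic < n%:R%:E)%E.

(** The indicator of the stochastic interval from 0 to the minimum of T and of the
    time of the n-th point. *)
Definition stopping (T : R) (n : nat) (t : R) (w : Om) : R :=
  ((t <= T) && `[< early n t w >])%:R.

Let time_rat_ge0 i : 0 <= time_rat i.
Proof. by rewrite /time_rat; case: unpickle => // q; rewrite le_max lexx orbT. Qed.

(** ]0, t[ is an increasing union of intervals ]0, q] with q rational, and measures
    are continuous along such unions. *)
Lemma early_count n t w : early n t w -> (N w `]0%R, t[%classic <= n%:R%:E)%E.
Proof.
move=> ent; rewrite itv_bnd_open_bigcup.
have := @nondecreasing_cvg_mu _ _ _ (N w)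
  (fun k : nat => `]0, t - k.+1%:R^-1]%classic).
move=> cvN.
have {}cvN : N w `]0, t - k.+1%:R^-1]%classic @[k --> \oo] -->
    N w (\bigcup_k `]0, t - k.+1%:R^-1]%classic).
  apply: cvN => //; first by apply: bigcupT_measurable => k.
  move=> a b ab; apply/subsetPset => x /=; rewrite !in_itv/=.
  move=> /andP[-> /le_trans]; apply.
  by rewrite lerD2l lerN2 lef_pV2 ?posrE// ler_nat.
rewrite -(cvg_lim _ cvN)//; apply: lime_le; first by apply/cvg_ex; eexists; exact: cvN.
near=> k.
(* A rational q between t - 1/(k+1) and t turns early into a bound on N. *)
have /rat_in_itvoo[q] : t - k.+1%:R^-1 < t by rewrite ltrBlDr ltrDl invr_gt0.
rewrite in_itv/= => /andP[kq qt].
have [q0|q0] := ltP (ratr q) (0 : R).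
  rewrite set_itv_ge ?measure0 ?lee_fin// bnd_simp -leNgt.
  by rewrite (le_trans (ltW kq))// ltW.
have qE : time_rat (pickle q) = ratr q by rewrite /time_rat pickleK max_l.
have := ent (pickle q); rewrite qE => /(_ qt)/ltW; apply: le_trans.
apply: le_measure; rewrite ?inE//; apply: subset_itvl.
by rewrite bnd_simp ltW.
Unshelve. all: by end_near. Qed.

Lemma early_of_count n t w : (N w `]0%R, t[%classic < n%:R%:E)%E -> early n t w.
Proof.
move=> + i it; apply: le_lt_trans.
apply: le_measure; rewrite ?inE//; apply: subset_itvl.
by rewrite bnd_simp.
Qed.

Lemma stopping_ge0 T n t w : 0 <= stopping T n t w.
Proof. exact: ler0n. Qed.

Lemma stopping_le1 T n t w : stopping T n t w <= 1.
Proof. by rewrite /stopping; case: (_ && _). Qed.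

Lemma stopping_nonincreasing T n s t w : s <= t ->
  stopping T n t w <= stopping T n s w.
Proof.
move=> st; rewrite /stopping ler_nat.
case: (leP t T) => //= tT; case: asboolP => // ent.
rewrite (le_trans st tT)/=; case: asboolP => // -[] i si.
by apply: ent; exact: lt_le_trans st.
Qed.

(** An indicator is predictable as soon as the set where it vanishes is. *)
Lemma predictable_stopping T n : 0 <= T -> predictable N (stopping T n).
Proof.
move=> T0.
pose late := (`]T, +oo[ `*` [set: Om]) `|`
  \bigcup_i (`]time_rat i, +oo[ `*` [set w | (n%:R%:E <= N w `]0%R, time_rat i]%classic)%E]).
have plate : predictable_sigma N late.
  apply: predictable_sigmaU.
    by apply: predictable_sigma_ray => //; exact: historyT.
  apply: sigma_algebra_bigcup => i; apply: predictable_sigma_ray => //.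
  apply: sub_sigma_algebra; exists `]0, time_rat i]%classic, `[n%:R%:E, +oo%E]%classic.
  split => //; first exact: emeasurable_itv.
  by apply/seteqP; split => w /=; rewrite in_itv/= ?leey ?andbT// => /andP[].
have lateP t w : late (t, w) <-> stopping T n t w = 0.
  rewrite /stopping; split.
    move=> [[/= + _]|[i _ [/=]]]; rewrite in_itv/= andbT.
      by rewrite ltNge => /negbTE ->.
    move=> it Nn; case: asboolP => [/(_ _ it)|]; last by rewrite andbF.
    by rewrite ltNge Nn.
  case: leP => [tT|Tt _]; last by left; split => //=; rewrite in_itv/= Tt.
  case: asboolP => //=; first by move=> _ /eqP; rewrite oner_eq0.
  move=> + _; move=> /existsNP[i /not_implyP[it /negP]]; rewrite -leNgt => Nn.
  by right; exists i => //; split => //=; rewrite in_itv/= it.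
have notlateP t w : ~ late (t, w) <-> stopping T n t w = 1.
  rewrite lateP /stopping; case: (_ && _) => /=; split => //; last first.
    by move=> /esym/eqP; rewrite oner_eq0.
  by move=> _ /eqP; rewrite oner_eq0.
have late_pos : late `<=` `]0, +oo[ `*` [set: Om].
  move=> [t w] [[/= + _]|[i _ [/= + _]]]; rewrite !in_itv/= !andbT.
    by move=> Tt; split => //; exact: le_lt_trans Tt.
  by move=> it; split => //; exact: le_lt_trans it.
move=> B mB.
rewrite (_ : _ `&` _ =
  (if 0 \in B then late else set0) `|`
  (if 1 \in B then (`]0, +oo[ `*` [set: Om]) `\` late else set0)).
  by apply: predictable_sigmaU; case: ifP => // _;
    [exact: sigma_algebra0|exact: sigma_algebraCD|exact: sigma_algebra0].
apply/seteqP; split => -[t w].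
  move=> [tw /= Bs]; have [l|l] := pselect (late (t, w)).
    by left; rewrite mem_set// -((lateP _ _).1 l).
  by right; rewrite mem_set// -((notlateP _ _).1 l).
move=> [|]; case: ifPn => //; rewrite inE => B1.
  by move=> l; split; [exact: late_pos|rewrite /= ((lateP _ _).1 l)].
by move=> [tw l]; split => //=; rewrite ((notlateP _ _).1 l).
Qed.

End predictability.

(** * Excitation along a fixed configuration of points *)

Section path.
Context (R : realType) (m : {measure set (measurableTypeR R) -> \bar R}).
Hypothesis m_neg : m `]-oo, 0]%classic = 0%E.
Hypothesis m_fin : forall t : R, (m `]0%R, t]%classic < +oo)%E.
Variables (g : R -> R) (B : R).
Hypothesis mg : measurable_fun [set: R] g.
Hypothesis g0 : forall t, 0 <= g t.
Hypothesis gB : forall t, 0 <= t -> g t <= B.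

Let m_sigma_finite : sigma_finite [set: measurableTypeR R] m.
Proof.
exists (fun k : nat => `]-oo, k%:R]%classic).
  apply/esym; rewrite -subTset => x _; exists (Num.truncn x).+1 => //=.
  by rewrite in_itv/= ltW// truncnS_gt.
move=> k; split => //.
rewrite (_ : `]-oo, k%:R]%classic = `]-oo, 0]%classic `|` `]0, k%:R]%classic); last first.
  by rewrite -itv_bndbnd_setU ?bnd_simp.
rewrite (le_lt_trans (measureU2 _ _ _))//.
by move: (m_neg) => /= ->; rewrite add0e.
Qed.

Let m_sfinite_mixin := isSFinite.Build _ _ _ (Measure.sort m)
  (sfinite_measure_sigma_finite m_sigma_finite).

Let m_sigma_finite_mixin := isSigmaFinite.Build _ _ _ (Measure.sort m)
  m_sigma_finite.

Let m' : {sigma_finite_measure set (measurableTypeR R) -> \bar R} :=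
  HB.pack_for (SigmaFiniteMeasure.type (measurableTypeR R) R) (Measure.sort m)
    m_sfinite_mixin m_sigma_finite_mixin.

Let mg_shift t : measurable_fun [set: R] (fun s => (g (t - s))%:E).
Proof.
apply/measurable_EFinP; apply: (measurableT_comp mg).
exact: measurable_funB.
Qed.

Lemma excitation_le t :
  (\int[m]_(s in `]0%R, t[) (g (t - s))%:E <= B%:E * m `]0%R, t[%classic)%E.
Proof.
rewrite -integral_cst//; apply: ge0_le_integral => //.
- by move=> s _; rewrite lee_fin.
- exact: measurable_funTS (mg_shift t).
- by move=> s /=; rewrite in_itv/= => /andP[_ /ltW st]; rewrite lee_fin gB// subr_ge0.
Qed.

Lemma excitation_finE t :
  ((\int[m]_(s in `]0, t[) g (t - s))%:E =
   \int[m]_(s in `]0%R, t[) (g (t - s))%:E)%E.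
Proof.
rewrite /Rintegral fineK// ge0_fin_numE; last first.
  by apply: integral_ge0 => s _; rewrite lee_fin.
apply: le_lt_trans (excitation_le t) _.
have mt : (m `]0%R, t[%classic < +oo)%E.
  apply: le_lt_trans (m_fin t); apply: le_measure; rewrite ?inE//.
  exact: subset_itv_oo_oc.
by rewrite lte_mul_pinfty// ?lee_fin (le_trans (g0 0))// gB.
Qed.

(** The pathwise form of the branching structure: each point s contributes
    g (t - s) at all later times t, so integrating the excitation in time is the
    same as summing over points the weight that each of them emits before T.  It
    is Tonelli's theorem for Lebesgue measure and m, the latter being
    sigma-finite because it is finite on bounded intervals. *)
Lemma excitation_exchange (T : R) (c : R -> R) :
  measurable_fun `]0, T] c -> (forall t, 0 < t <= T -> 0 <= c t) ->
  (\int[lebesgue_measure]_(t in `]0%R, T])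
     (c t * \int[m]_(s in `]0, t[) g (t - s))%:E =
   \int[m]_(s in `]0%R, +oo[)
     \int[lebesgue_measure]_(t in `]s, T]) (c t * g (t - s))%:E)%E.
Proof.
move=> mc c0.
pose c' := c \_ `]0, T].
have mc' : measurable_fun [set: R] c'.
  by apply/(measurable_restrictT _ _).1.
have c'0 t : 0 <= c' t.
  rewrite /c' patchE; case: ifPn => //; rewrite inE/= in_itv/=; exact: c0.
pose A : set (measurableTypeR R * measurableTypeR R) :=
  [set p | 0 < p.2] `&` [set p | 0 < p.1 - p.2].
have mA : measurable A.
  apply: measurableI.
    rewrite (_ : [set p | _] = setT `&` snd @^-1` `]0, +oo[%classic).
      exact: measurable_snd.
    by rewrite setTI; apply/seteqP; split => p /=; rewrite in_itv/= andbT.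
  rewrite (_ : [set p | _] = setT `&` (fun p => p.1 - p.2) @^-1` `]0, +oo[%classic).
    by apply: measurable_funB.
  by rewrite setTI; apply/seteqP; split => p /=; rewrite in_itv/= andbT.
pose F (p : measurableTypeR R * measurableTypeR R) : \bar R :=
  (c' p.1 * g (p.1 - p.2) * \1_A p)%:E.
have mF : measurable_fun setT F.
  apply/measurable_EFinP; apply: measurable_funM; last exact: measurable_indic.
  apply: measurable_funM; first exact: (measurableT_comp mc').
  apply: (measurableT_comp mg); exact: measurable_funB.
have F0 p : (0 <= F p)%E by rewrite lee_fin !mulr_ge0.
have := fubini_tonelli (m1 := lebesgue_measure) (m2 := m') _ mF F0.
have AE t s : A (t, s) <-> 0 < s < t.
  by rewrite /A/= subr_gt0; split => [[-> ->]|/andP[]].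
move=> FT.
transitivity (\int[lebesgue_measure]_x \int[m']_y F (x, y))%E.
  rewrite integral_mkcond; apply: eq_integral => t _; rewrite patchE.
  case: ifPn => tT; last first.
    apply/esym/integral0_eq => s _.
    by rewrite /F/= /c' patchE (negbTE tT) !mul0r.
  rewrite EFinM excitation_finE -ge0_integralZl//; last 3 first.
  - exact: measurable_funTS (mg_shift t).
  - by move=> s _; rewrite lee_fin.
  - by move: tT; rewrite inE/= in_itv/= lee_fin; exact: c0.
  rewrite integral_mkcond; apply: eq_integral => s _.
  rewrite patchE /F/= /c' patchE tT indicE.
  case: ifPn; rewrite ?inE/= => st.
    by rewrite mem_set ?mulr1 ?EFinM//; apply/AE; rewrite in_itv/= in st.
  rewrite memNset ?mulr0// => /AE ?; move/negP : st; apply.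
  by rewrite inE/= in_itv.
rewrite FT [RHS]integral_mkcond; apply: eq_integral => s _; rewrite patchE.
case: ifPn => s0; last first.
  apply/integral0_eq => t _; rewrite /F indicE memNset ?mulr0//.
  move=> /AE/andP[sp _]; move/negP : s0; apply.
  by rewrite inE/= in_itv/= sp.
rewrite inE/= in_itv/= andbT in s0.
rewrite [RHS]integral_mkcond; apply: eq_integral => t _.
rewrite patchE /F/= /c' patchE indicE.
case: (boolP (t \in `]s, T]%classic)) => [|stN].
  rewrite inE/= in_itv/= => /andP[st tT].
  rewrite !mem_set ?mulr1//; first by apply/AE; rewrite s0.
  by rewrite /= in_itv/= tT (lt_trans s0).
case: ifPn => [|_]; last by rewrite !mul0r.
rewrite inE/= in_itv/= => /andP[t0 tT].
rewrite memNset ?mulr0// => /AE/andP[_ st]; move/negP : stN; apply.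
by rewrite inE/= in_itv/= st.
Qed.

End path.

(** * Mean intensity of a Hawkes process *)

Lemma integral_zero_outside d (X : measurableType d) (R : realType)
    (m : {measure set X -> \bar R}) (D E : set X) (f : X -> \bar R) :
  E `<=` D -> (forall x, D x -> ~ E x -> f x = 0%E) ->
  (\int[m]_(x in D) f x = \int[m]_(x in E) f x)%E.
Proof.
move=> ED f0; rewrite integral_mkcond [RHS]integral_mkcond.
apply: eq_integral => x _; rewrite !patchE.
case: ifPn => xD; case: ifPn => xE //.
- by apply: f0; [rewrite inE in xD|rewrite notin_setE in xE].
- by move: xD; rewrite notin_setE => xD; case: xD; rewrite inE in xE; exact: ED.
Qed.

Lemma slab_integral_cst d (Om : measurableType d) (R : realType)
    (P : probability Om R) (T : R) (T0 : 0 <= T) (x : R) :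
  (\int[P]_w \int[lebesgue_measure]_(t in `]0%R, T]) x%:E)%E = (x * T)%:E.
Proof.
under eq_integral do rewrite integral_cst//=.
rewrite integral_cst//= probability_setT mule1 lebesgue_measure_itv/= lte_fin.
case: ltP => [_|T00]; first by rewrite oppr0 adde0 EFinM.
have -> : T = 0 by apply/le_anti; rewrite T00.
by rewrite mulr0 mule0.
Qed.

Section hawkes.
Context d (Om : measurableType d) (R : realType) (P : probability Om R).
Variable N : R.-ker Om ~> measurableTypeR R.
Variables (g : R -> R) (B mu rho : R).
Hypothesis mg : measurable_fun [set: R] g.
Hypothesis g0 : forall t, 0 <= g t.
Hypothesis gB : forall t, 0 <= t -> g t <= B.
Hypothesis g1 : forall s T, s <= T ->
  (\int[lebesgue_measure]_(t in `]s, T]) (g (t - s))%:E <= 1)%E.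
Hypothesis mu0 : 0 < mu.
Hypothesis rho0 : 0 < rho.
Hypothesis rho1 : rho < 1.
Hypothesis hN : hawkes_process P g mu rho N.

Let lam (t : R) (w : Om) := hawkes_intensity g mu rho (N w) t.

Let Phi (t : R) (w : Om) := \int[N w]_(s in `]0, t[) g (t - s).

Let N_neg w : N w `]-oo, 0]%classic = 0%E.
Proof. by case: hN => -[]. Qed.

Let N_fin w t : (N w `]0%R, t]%classic < +oo)%E.
Proof.
case: hN => -[_ Nn _] _.
by have [//||n ->] := Nn w t `]0, t]%classic; rewrite ?ltry.
Qed.

Let lamE t w : lam t w = mu + rho * Phi t w. Proof. by []. Qed.

Let Phi_ge0 t w : 0 <= Phi t w.
Proof. by apply: Rintegral_ge0 => s _. Qed.

Lemma intensity_ge t w : mu <= hawkes_intensity g mu rho (N w) t.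
Proof. by rewrite -/(lam t w) lamE lerDl mulr_ge0// ltW. Qed.

Let lam_ge0 t w : 0 <= lam t w.
Proof. exact: le_trans (ltW mu0) (intensity_ge _ _). Qed.

Lemma measurable_intensity (T : R) : measurable_fun (`]0, T] `*` [set: Om])
  (fun p : R * Om => hawkes_intensity g mu rho (N p.2) p.1).
Proof.
case: hN => _ [/predictable_measurable_fun mlam _ _].
apply: measurable_funS mlam.
- exact: measurableX.
- by move=> [t w] [/= + _]; rewrite !in_itv/= andbT => /andP[].
Qed.

Let measurable_Phi (T : R) : measurable_fun (`]0, T] `*` [set: Om])
  (fun p : R * Om => Phi p.1 p.2).
Proof.
apply: (eq_measurable_fun (fun p => (lam p.1 p.2 - mu) / rho)).
  by move=> p _; rewrite lamE addrC addKr mulrC mulKf// gt_eqF.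
apply: measurable_funM => //; apply: measurable_funB => //.
exact: measurable_intensity.
Qed.

Let ray_split (T : R) : `]0, T]%classic `<=` `](0 : R), +oo[%classic.
Proof. by move=> t /=; rewrite !in_itv/= andbT => /andP[]. Qed.

Let ray_late (T t : R) : `](0 : R), +oo[%classic t -> ~ `]0, T]%classic t -> T < t.
Proof. by rewrite /= !in_itv/= andbT => ->/= /negP; rewrite -ltNge. Qed.

Let compensator (C : R -> Om -> R) (T : R) : 
  predictable N C -> (forall t w, 0 <= C t w) ->
  (forall t w, T < t -> C t w = 0) ->
  (\int[P]_w \int[N w]_(t in `]0%R, +oo[) (C t w)%:E =
   \int[P]_w \int[lebesgue_measure]_(t in `]0%R, T]) (C t w * lam t w)%:E)%E.
Proof.
move=> pC C0 CT; have [_ [_ _ hC]] := hN; rewrite (hC C pC C0).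
apply: eq_integral => w _; apply: integral_zero_outside; first exact: ray_split.
by move=> t t0 /(ray_late t0) Tt; rewrite CT// mul0r.
Qed.

Lemma measurable_stopping (T : R) n : 0 <= T ->
  measurable_fun (`]0, T] `*` [set: Om])
    (fun p : R * Om => stopping N T n p.1 p.2).
Proof.
move=> T0; have := predictable_measurable_fun (predictable_stopping (N := N) n T0).
apply: measurable_funS.
- exact: measurableX.
- by move=> [t w] [/= + _]; rewrite !in_itv/= andbT => /andP[].
Qed.

Section stopped.
Variables (T : R) (T0 : 0 <= T) (n : nat).

Let C := stopping N T n.

Let C0 t w : 0 <= C t w. Proof. exact: stopping_ge0. Qed.

Let mC : measurable_fun (`]0, T] `*` [set: Om]) (fun p : R * Om => C p.1 p.2).
Proof. exact: measurable_stopping. Qed.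

(* The stopping indicator decreases in time, so the excitation emitted by a point
   before the stopping time is at most the mass of g times the indicator that the
   point itself occurred before it. *)
Let stopped_excitation_le w :
  (\int[lebesgue_measure]_(t in `]0%R, T]) (C t w * Phi t w)%:E <=
   \int[N w]_(s in `]0%R, +oo[) (C s w)%:E)%E.
Proof.
have mCw : measurable_fun `]0, T] (C ^~ w).
  apply/measurable_EFinP.
  have /measurable_EFinP mC' := mC.
  exact: (slab_measurable_path (measurable_itv _) mC').
rewrite (excitation_exchange (N_neg w) (N_fin w) mg g0 gB)//.
apply: ge0_le_integral_lower => s; rewrite /= in_itv/= andbT => s0.
  by apply: integral_ge0 => t _; rewrite lee_fin mulr_ge0.
have [Ts|sT] := ltP T s.
  by rewrite set_itv_ge ?integral_set0 ?lee_fin// bnd_simp -leNgt ltW.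
apply: (@le_trans _ _ (\int[lebesgue_measure]_(t in `]s, T])
    ((C s w)%:E * (g (t - s))%:E))%E).
  apply: ge0_le_integral_lower => t /=; rewrite in_itv/= => /andP[st tT].
    by rewrite lee_fin mulr_ge0.
  by rewrite -EFinM lee_fin ler_wpM2r// stopping_nonincreasing// ltW.
rewrite ge0_integralZl//; last 3 first.
- apply/measurable_EFinP/measurable_funTS/(measurableT_comp mg).
  exact: measurable_funB.
- by move=> t _; rewrite lee_fin.
- by rewrite lee_fin.
by rewrite -[leRHS]mule1 lee_wpmul2l ?lee_fin// g1.
Qed.

Let EFinT := slab_integral_cst P T0.

(** Stopped at the n-th point, the mean L_n of the integrated intensity is finite,
    since the excitation is then at most B * n; and by the branching structure
    L_n <= mu * T + rho * L_n.  Finiteness is what makes it legitimate to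
    solve this inequality for L_n. *)
Lemma stopped_intensity_le :
  (\int[P]_w \int[lebesgue_measure]_(t in `]0%R, T])
     (stopping N T n t w * hawkes_intensity g mu rho (N w) t)%:E
   <= (mu * T / (1 - rho))%:E)%E.
Proof.
rewrite -/C; set L := (X in (X <= _)%E).
have CL0 t w : 0 <= C t w * hawkes_intensity g mu rho (N w) t.
  by rewrite mulr_ge0// lam_ge0.
have L0 : (0 <= L)%E.
  by apply: integral_ge0 => w _; apply: integral_ge0 => t _; rewrite lee_fin.
have Lfin : (L <= ((mu + rho * (B * n%:R)) * T)%:E)%E.
  rewrite -EFinT; apply: ge0_le_integral_lower => w _.
    by apply: integral_ge0 => t _; rewrite lee_fin.
  apply: ge0_le_integral_lower => t _; first by rewrite lee_fin.
  have B0 : 0 <= B by rewrite (le_trans (g0 0))// gB.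
  rewrite lee_fin /C /stopping; case: (boolP (_ && _)) => [/andP[_ /asboolP ent]|_].
    rewrite mul1r -/(lam t w) lamE lerD2l ler_wpM2l ?(ltW rho0)//.
    rewrite -lee_fin (excitation_finE (N_fin w) mg g0 gB).
    apply: le_trans (excitation_le _ mg g0 gB t) _.
    by rewrite EFinM lee_wpmul2l ?lee_fin// early_count.
  by rewrite mul0r addr_ge0 ?mulr_ge0// ltW.
pose U := (\int[P]_w \int[lebesgue_measure]_(t in `]0%R, T]) (C t w * Phi t w)%:E)%E.
have UL : (U <= L)%E.
  rewrite /L /C -(compensator (predictable_stopping (N := N) n T0))//; last first.
    by move=> t w; rewrite ltNge /stopping => /negbTE ->.
  apply: ge0_le_integral_lower => w _; last exact: stopped_excitation_le.
  by apply: integral_ge0 => t _; rewrite lee_fin mulr_ge0.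
have mCP : measurable_fun (`]0, T] `*` [set: Om])
    (fun p : R * Om => (C p.1 p.2 * Phi p.1 p.2)%:E).
  by apply/measurable_EFinP/measurable_funM => //; exact: measurable_Phi.
have CP0 (p : R * Om) : (`]0, T] `*` [set: Om]) p -> (0 <= (C p.1 p.2 * Phi p.1 p.2)%:E)%E.
  by move=> _; rewrite lee_fin mulr_ge0.
(* The immigrants contribute at most mu * T, their offspring rho * U. *)
have LU : (L <= (mu * T)%:E + rho%:E * U)%E.
  rewrite -EFinT /U -ge0_integralZl//; last 3 first.
  - exact: (slab_measurable_integral (measurable_itv _) mCP CP0).
  - by move=> w _; apply: integral_ge0 => t _; rewrite lee_fin mulr_ge0.
  - by rewrite lee_fin ltW.
  rewrite -ge0_integralD//; last 3 first.
  - by move=> w _; apply: integral_ge0 => t _; rewrite lee_fin ltW.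
  - move=> w _; apply: mule_ge0; first by rewrite lee_fin ltW.
    by apply: integral_ge0 => t _; rewrite lee_fin mulr_ge0.
  - apply: measurable_funeM; exact: (slab_measurable_integral (measurable_itv _) mCP CP0).
  apply: ge0_le_integral_lower => w _.
    by apply: integral_ge0 => t _; rewrite lee_fin.
  have mCPw := slab_measurable_path (measurable_itv _) mCP w.
  rewrite -ge0_integralZl//; last 2 first.
  - by move=> t _; rewrite lee_fin mulr_ge0.
  - by rewrite lee_fin ltW.
  rewrite -ge0_integralD//; last 3 first.
  - by move=> t _; rewrite lee_fin ltW.
  - by move=> t _; rewrite -EFinM lee_fin !mulr_ge0// ltW.
  - exact: measurable_funeM.
  apply: ge0_le_integral_lower => t _; first by rewrite lee_fin.
  rewrite -EFinM -EFinD lee_fin -/(lam t w) lamE mulrDr mulrCA lerD2r.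
  by rewrite ger_pMl// stopping_le1.
have Lr : L \is a fin_num by rewrite ge0_fin_numE// (le_lt_trans Lfin) ?ltry.
have {}LU : (L <= (mu * T)%:E + rho%:E * L)%E.
  apply: (le_trans LU); apply: leeD2l; apply: lee_wpmul2l => //.
  by rewrite lee_fin ltW.
move: LU; rewrite -(fineK Lr) -EFinM -EFinD !lee_fin => LU.
by rewrite ler_pdivlMr ?subr_gt0//; lra.
Qed.

End stopped.

Let mlamE (T : R) : measurable_fun (`]0, T] `*` [set: Om])
  (fun p : R * Om => (lam p.1 p.2)%:E).
Proof. by apply/measurable_EFinP; exact: measurable_intensity. Qed.

(** Localisation: only finitely many points occur before T, so for each
    configuration the stopped integrals become constant in n, and monotone
    convergence transfers the bound of stopped_intensity_le. *)
Lemma expected_intensity_le (T : R) : 0 <= T ->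
  (\int[P]_w \int[lebesgue_measure]_(t in `]0%R, T])
     (hawkes_intensity g mu rho (N w) t)%:E <= (mu * T / (1 - rho))%:E)%E.
Proof.
move=> T0.
pose Y n w := (\int[lebesgue_measure]_(t in `]0%R, T])
  (stopping N T n t w * lam t w)%:E)%E.
have mC n : measurable_fun (`]0, T] `*` [set: Om])
    (fun p : R * Om => (stopping N T n p.1 p.2 * lam p.1 p.2)%:E).
  apply/measurable_EFinP/measurable_funM; last exact: measurable_intensity.
  exact: measurable_stopping.
have C0 n (p : R * Om) : (`]0, T] `*` [set: Om]) p ->
    (0 <= (stopping N T n p.1 p.2 * lam p.1 p.2)%:E)%E.
  by move=> _; rewrite lee_fin mulr_ge0// stopping_ge0.
have mY n : measurable_fun setT (Y n).
  exact: (slab_measurable_integral (measurable_itv _) (mC n) (C0 n)).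
have Y0 n w : (0 <= Y n w)%E.
  by apply: integral_ge0 => t _; rewrite lee_fin mulr_ge0// stopping_ge0.
have ndY w a b : (a <= b)%N -> (Y a w <= Y b w)%E.
  move=> ab; apply: ge0_le_integral_lower => t _.
    by rewrite lee_fin mulr_ge0// stopping_ge0.
  rewrite lee_fin ler_wpM2r// /stopping ler_nat.
  case: (t <= T) => //=; case: asboolP => // ea.
  case: asboolP => // -[] i it; apply: lt_le_trans (ea i it) _.
  by rewrite lee_fin ler_nat.
have cvY := @cvg_monotone_convergence _ _ _ P setT measurableT Y mY
  (fun n w _ => Y0 n w) (fun w _ => ndY w).
have limY w : limn (Y^~ w) =
    (\int[lebesgue_measure]_(t in `]0%R, T]) (lam t w)%:E)%E.
  apply: cvg_lim => //; apply: cvg_near_cst; near=> n.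
  apply: eq_integral => t; rewrite inE/= in_itv/= => /andP[_ tT].
  rewrite /stopping tT asboolT ?mul1r//.
  apply: early_of_count; apply: (@le_lt_trans _ _ (N w `]0%R, T]%classic)).
    apply: le_measure; rewrite ?inE//.
    by apply: subset_itvl; rewrite bnd_simp.
  have Nfin := N_fin w T.
  rewrite -(@fineK _ (N w `]0%R, T]%classic)) ?ge0_fin_numE// lte_fin.
  near: n; exact: nbhs_infty_gtr.
rewrite (eq_integral (fun w => limn (Y^~ w))); last by move=> w _; rewrite limY.
rewrite -(cvg_lim _ cvY)//; apply: lime_le; first by apply/cvg_ex; eexists; exact: cvY.
by apply: nearW => n; exact: stopped_intensity_le.
Unshelve. all: by end_near. Qed.

(** The mean intensity satisfies a renewal equation.  Tested against c t = T - t it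
    reads X = mu * T ^+ 2 / 2 + rho * U, where X is the mean of the integral of
    c * lambda and U that of c * Phi.  By excitation_exchange, U sums over
    the points s the integral of c t * g (t - s), which is at least
    c s - K by hypothesis; so U >= X - K * L.  With X <= T * L the claim
    follows.  A linear test function, unlike a constant one, gives little weight to
    the points near T, whose offspring mostly fall outside the window. *)
Lemma expected_intensity_ge (T K : R) : 0 < T -> 0 <= K ->
  (forall s, 0 < s <= T -> ((T - s - K)%:E <=
    \int[lebesgue_measure]_(t in `]s, T]) ((T - t) * g (t - s))%:E)%E) ->
  mu * T ^+ 2 / 2 <= ((1 - rho) * T + K) *
    fine (\int[P]_w \int[lebesgue_measure]_(t in `]0%R, T])
     (hawkes_intensity g mu rho (N w) t)%:E)%E.
Proof.
move=> T0 K0 hK.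
have := expected_intensity_le (ltW T0).
set L := (\int[P]_w _)%E => Lle.
have L0 : (0 <= L)%E.
  by apply: integral_ge0 => w _; apply: integral_ge0 => t _; rewrite lee_fin lam_ge0.
have Lfin : L \is a fin_num by rewrite ge0_fin_numE// (le_lt_trans Lle)// ltry.
pose c (t : R) := Num.max (T - t) 0.
have c0 t : 0 <= c t by rewrite le_max lexx orbT.
have cE t : t <= T -> c t = T - t by move=> tT; rewrite /c max_l// subr_ge0.
have mc : measurable_fun [set: R] c.
  by apply: measurable_maxr => //; exact: measurable_funB.
pose k (t : R) : R := (t <= T)%R%:R.
have mk : measurable_fun [set: R] k.
  rewrite (_ : k = \1_(`]-oo, T]%classic)); last first.
    by apply/funext => t; rewrite indicE /k mem_setE in_itv.
  exact: measurable_indic.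
have mcT : measurable_fun (`]0, T] `*` [set: Om]) (fun p : R * Om => c p.1).
  by apply: (measurableT_comp mc); apply: measurable_funTS; exact: measurable_fst.
pose X := (\int[P]_w \int[lebesgue_measure]_(t in `]0%R, T]) (c t * lam t w)%:E)%E.
pose u w := (\int[lebesgue_measure]_(t in `]0%R, T]) (c t * Phi t w)%:E)%E.
have mcP : measurable_fun (`]0, T] `*` [set: Om])
    (fun p : R * Om => (c p.1 * Phi p.1 p.2)%:E).
  by apply/measurable_EFinP/measurable_funM => //; exact: measurable_Phi.
have cP0 (p : R * Om) : (`]0, T] `*` [set: Om]) p -> (0 <= (c p.1 * Phi p.1 p.2)%:E)%E.
  by move=> _; rewrite lee_fin mulr_ge0.
have mu_ : measurable_fun setT u.
  exact: (slab_measurable_integral (measurable_itv _) mcP cP0).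
have u0 w : (0 <= u w)%E.
  by apply: integral_ge0 => t _; rewrite lee_fin mulr_ge0.
pose U := (\int[P]_w u w)%E.
have U0 : (0 <= U)%E by exact: integral_ge0.
have cint : (\int[lebesgue_measure]_(t in `]0%R, T]) (mu * c t)%:E)%E
    = (mu * T ^+ 2 / 2)%:E.
  pose F t : R := - (mu / 2) * ((T - t) * (T - t)).
  transitivity (\int[lebesgue_measure]_(t in `]0%R, T]) (mu * (T - t))%:E)%E.
    apply: eq_integral => t.
    by rewrite inE/= in_itv/= => /andP[_ tT]; rewrite cE.
  have dF t : 0 <= t <= T -> is_derive t 1 F (mu * (T - t)).
    move=> _; have h1 : is_derive t 1 (fun x : R => T - x) (-1).
      have := is_deriveB (is_derive_cst T t 1) (is_derive_id t 1).
      by rewrite sub0r.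
    have h2 := is_deriveZ (- (mu / 2)) (is_deriveM h1 h1).
    apply: DeriveDef; first exact: (@ex_derive _ _ _ _ _ _ _ h2).
    rewrite (@derive_val _ _ _ _ _ _ _ h2) /GRing.scale/=.
    by field.
  have cF t : 0 <= t <= T -> {for t, continuous (fun x => mu * (T - x))}.
    move=> _; apply: continuousM; first exact: cvg_cst.
    by apply: continuousB; [exact: cvg_cst|exact: cvg_id].
  rewrite (integral_derivative (ltW T0) dF cF).
  by rewrite /F subrr; congr EFin; field.
have XE : X = ((mu * T ^+ 2 / 2)%:E + rho%:E * U)%E.
  rewrite -cint /U -ge0_integralZl//; last by rewrite lee_fin ltW.
  rewrite -[X in (X + _)%E]mule1 -[X in (_ * X + _)%E](probability_setT P).
  rewrite -integral_cst// -ge0_integralD//; last 3 first.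
  - by move=> w _; apply: integral_ge0 => t _; rewrite lee_fin mulr_ge0// ltW.
  - by move=> w _; apply: mule_ge0 => //; rewrite lee_fin ltW.
  - exact: measurable_funeM.
  apply: eq_integral => w _.
  have mcPw := slab_measurable_path (measurable_itv _) mcP w.
  rewrite /u -ge0_integralZl//; last 2 first.
  - by move=> t _; rewrite lee_fin mulr_ge0.
  - by rewrite lee_fin ltW.
  rewrite /= -ge0_integralD//; last 4 first.
  - by move=> t _; rewrite lee_fin mulr_ge0// ltW.
  - by apply/measurable_EFinP/measurable_funM => //; exact: measurable_funTS.
  - by move=> t _; rewrite -EFinM lee_fin !mulr_ge0// ltW.
  - exact: measurable_funeM.
  apply: eq_integral => t _; rewrite -EFinM -EFinD; congr EFin.
  by rewrite lamE mulrDr mulrC [in RHS]mulrCA.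
(* The mean number of points before T is the mean integrated intensity. *)
have count : (\int[P]_w N w `]0%R, T]%classic = L)%E.
  transitivity (\int[P]_w \int[N w]_(t in `]0%R, +oo[) (k t)%:E)%E.
    apply: eq_integral => w _.
    transitivity (\int[N w]_(t in `]0%R, T]) (k t)%:E)%E.
      rewrite (eq_integral (cst 1%E)) ?integral_cst ?mul1e// => t.
      by rewrite inE/= in_itv/= /k => /andP[_ ->].
    apply/esym/integral_zero_outside; first exact: ray_split.
    by move=> t t0 /(ray_late t0) Tt; rewrite /k leNgt Tt.
  rewrite (@compensator (fun t _ => k t) T); last 3 first.
  - exact: predictable_deterministic.
  - by move=> t w; rewrite /k.
  - by move=> t w; rewrite ltNge /k => /negbTE ->.
  apply: eq_integral => w _; apply: eq_integral => t.
  by rewrite inE/= in_itv/= /k => /andP[_ ->]; rewrite mul1r.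
have XU : (X <= U + K%:E * L)%E.
  rewrite /X -(@compensator (fun t _ => c t) T)//; last 2 first.
  - exact: predictable_deterministic.
  - by move=> t w Tt; rewrite /c max_r// subr_le0 ltW.
  have mNT : measurable_fun setT (fun w => N w `]0%R, T]%classic).
    exact: measurable_kernel.
  rewrite -count -ge0_integralZl// -ge0_integralD//; last 2 first.
  - by move=> w _; apply: mule_ge0.
  - exact: measurable_funeM.
  apply: ge0_le_integral_lower => w _.
    by apply: integral_ge0 => t _; rewrite lee_fin.
  (* h is a measurable minorant of the weight that a point at s emits; it
     avoids arguing on the measurability of that weight in s. *)
  pose h (s : R) := Num.max (c s - K) 0.
  have mh : measurable_fun [set: R] h.
    by apply: measurable_maxr => //; exact: measurable_funB.
  have h0 s : 0 <= h s by rewrite le_max lexx orbT.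
  have hu : (\int[N w]_(s in `]0%R, +oo[) (h s)%:E <= u w)%E.
    rewrite /u (excitation_exchange (N_neg w) (N_fin w) mg g0 gB)//; last first.
      exact: measurable_funTS.
    apply: ge0_le_integral_lower => s; rewrite /= in_itv/= andbT => s0.
      by rewrite lee_fin.
    have [Ts|sT] := ltP T s.
      rewrite set_itv_ge ?integral_set0; last by rewrite bnd_simp -leNgt ltW.
      have cs : c s = 0 by rewrite /c max_r// subr_le0 ltW.
      by rewrite lee_fin /h cs max_r// sub0r oppr_le0.
    rewrite (_ : integral _ _ _ =
      \int[lebesgue_measure]_(t in `]s, T]) ((T - t) * g (t - s))%:E)%E; last first.
      apply: eq_integral => t.
      by rewrite inE/= in_itv/= => /andP[_ tT]; rewrite cE.
    rewrite /h cE//; have [_|_] := leP (T - s - K) 0; last first.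
      by apply: hK; rewrite s0.
    apply: integral_ge0 => t /=; rewrite in_itv/= => /andP[_ tT].
    by rewrite lee_fin mulr_ge0// subr_ge0.
  apply: (@le_trans _ _ (\int[N w]_(s in `]0%R, +oo[)
     ((h s)%:E + (K * k s)%:E))%E).
    apply: ge0_le_integral_lower => s _; first by rewrite lee_fin.
    rewrite -EFinD lee_fin /h /k; have [sT|Ts] := leP s T.
      rewrite mulr1; have [|] := leP (c s - K) 0; last by rewrite subrK.
      by rewrite subr_le0 add0r.
    by rewrite mulr0 addr0 /c max_r ?le_max ?lexx ?orbT// subr_le0 ltW.
  rewrite ge0_integralD//; last 4 first.
  - by move=> s _; rewrite lee_fin.
  - by apply/measurable_EFinP; exact: measurable_funTS.
  - by move=> s _; rewrite lee_fin mulr_ge0.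
  - by apply/measurable_EFinP/measurable_funM => //; exact: measurable_funTS.
  apply: leeD => //.
  apply: (@le_trans _ _ (\int[N w]_(t in `]0%R, T]) (K * k t)%:E)%E).
    rewrite le_eqVlt; apply/orP; left; apply/eqP.
    apply: integral_zero_outside; first exact: ray_split.
    by move=> t t0 /(ray_late t0) Tt; rewrite /k leNgt Tt mulr0.
  rewrite (eq_integral (cst K%:E)) ?integral_cst// => t.
  by rewrite inE/= in_itv/= /k => /andP[_ ->]; rewrite mulr1.
have XTL : (X <= T%:E * L)%E.
  rewrite /L -ge0_integralZl//; last 3 first.
  - apply: (slab_measurable_integral (measurable_itv _) (@mlamE T)).
    by move=> p _; rewrite lee_fin lam_ge0.
  - by move=> w _; apply: integral_ge0 => t _; rewrite lee_fin lam_ge0.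
  - by rewrite lee_fin ltW.
  apply: ge0_le_integral_lower => w _.
    by apply: integral_ge0 => t _; rewrite lee_fin mulr_ge0.
  have mlw := slab_measurable_path (measurable_itv _) (@mlamE T) w.
  rewrite -ge0_integralZl//; last 2 first.
  - by move=> t _; rewrite lee_fin lam_ge0.
  - by rewrite lee_fin ltW.
  apply: ge0_le_integral_lower => t /=; rewrite in_itv/= => /andP[t0 tT].
    by rewrite lee_fin mulr_ge0.
  rewrite -EFinM lee_fin ler_wpM2r ?lam_ge0// cE//.
  by rewrite lerBlDr lerDl ltW.
have Xfin : X \is a fin_num.
  rewrite ge0_fin_numE; first last.
    by apply: integral_ge0 => w _; apply: integral_ge0 => t _; rewrite lee_fin mulr_ge0.
  apply: (le_lt_trans XTL).
  by rewrite -(fineK Lfin) -EFinM ltry.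
clearbody U.
have Ufin : U \is a fin_num.
  rewrite ge0_fin_numE//; move: Xfin; rewrite XE.
  move: U U0 {XE XU} => [r _ _| |]//; first exact: ltry.
  by rewrite mulry gtr0_sg// mul1e addey.
clearbody X; move: XE XU XTL; rewrite -(fineK Xfin) -(fineK Ufin) -(fineK Lfin).
rewrite -!EFinM -!EFinD !lee_fin => -[XE] XU XTL.
have L0' : 0 <= fine L by rewrite fine_ge0.
have h1 : (1 - rho) * fine X <= (1 - rho) * (T * fine L).
  by rewrite ler_wpM2l// subr_ge0 ltW.
have h2 : rho * fine X <= rho * (fine U + K * fine L).
  by rewrite ler_wpM2l// ltW.
have h3 : rho * (K * fine L) <= K * fine L.
  by rewrite ler_piMl ?mulr_ge0// ltW.
lra.
Qed.

End hawkes.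

(** * The Fisher information matrix *)

Section fisher.
Context d (Om : measurableType d) (R : realType) (P : probability Om R).
Variable N : R.-ker Om ~> measurableTypeR R.
Variables (g : R -> R) (mu rho : R).
Hypothesis g0 : forall t, 0 <= g t.
Hypothesis mu0 : 0 < mu.
Hypothesis rho0 : 0 < rho.
Hypothesis rho1 : rho < 1.
Hypothesis hN : hawkes_process P g mu rho N.

Let lam (t : R) (w : Om) := hawkes_intensity g mu rho (N w) t.

Let lam_gt0 t w : 0 < lam t w.
Proof. exact: lt_le_trans mu0 (intensity_ge N mu g0 rho0 _ _). Qed.

Lemma grad_intensityE (n : {measure set (measurableTypeR R) -> \bar R}) t i :
  grad_intensity g (ln mu) (ln (1 - rho)) n t i 0 =
  if i == 0 then mu else - (1 - rho) * \int[n]_(s in `]0, t[) g (t - s).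
Proof.
rewrite /grad_intensity mxE; case: ifPn => _.
- rewrite derive1E /log_intensity /hawkes_intensity.
  have h := is_deriveD (is_derive_expR (ln mu)) (is_derive_cst
    ((1 - expR (ln (1 - rho))) * \int[n]_(s in `]0, t[) g (t - s)) (ln mu) 1).
  by rewrite (@derive_val _ _ _ _ _ _ _ h) addr0 lnK.
- rewrite derive1E /log_intensity /hawkes_intensity.
  set I := \int[n]_(s in _) _.
  have h := is_deriveD (is_derive_cst (expR (ln mu)) (ln (1 - rho)) 1)
    (is_deriveM (is_deriveB (is_derive_cst (1 : R) (ln (1 - rho)) 1)
                            (is_derive_expR (ln (1 - rho))))
                (is_derive_cst I (ln (1 - rho)) 1)).
  rewrite (@derive_val _ _ _ _ _ _ _ h) /GRing.scale/= mulr0 !add0r.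
  by rewrite mulrC lnK// posrE subr_gt0.
Qed.

(** Substituting Phi = (lambda - mu) / rho makes the integrand a function of
    lambda, for which joint measurability is known. *)
Lemma fisher_informationE T i j :
  fisher_information P g mu rho N T i j =
  fine (\int[P]_w \int[lebesgue_measure]_(t in `[0%R, T])
    ((if i == 0 then mu else - (1 - rho) * ((lam t w - mu) / rho)) *
     (if j == 0 then mu else - (1 - rho) * ((lam t w - mu) / rho)) /
     lam t w)%:E)%E.
Proof.
have gradE w t k : grad_intensity g (ln mu) (ln (1 - rho)) (N w) t k 0 =
    if k == 0 then mu else - (1 - rho) * ((lam t w - mu) / rho).
  rewrite grad_intensityE /lam /hawkes_intensity; case: ifP => // _.
  by field; rewrite gt_eqF.
rewrite mxE; congr fine; apply: eq_integral => w _; apply: eq_integral => t _.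
by rewrite -!gradE /= [(_ *m _) i j]mxE big_ord1 [_^T _ _]mxE.
Qed.

Section horizon.
Variables (T : R) (T0 : 0 < T).

Let measurable_lam : measurable_fun (`]0, T] `*` [set: Om])
  (fun p : R * Om => lam p.1 p.2).
Proof. exact: (measurable_intensity (T := T) hN). Qed.

Lemma measurable_intensity_inv : measurable_fun (`]0, T] `*` [set: Om])
  (fun p : R * Om => (lam p.1 p.2)^-1).
Proof.
apply: (eq_measurable_fun (fun p => (lam p.1 p.2) `^ (- 1))).
  by move=> p _; rewrite powR_inv1// ltW.
exact: (measurableT_comp (measurable_powR (R := R) (- 1)) measurable_lam).
Qed.

(** The information integrates over [0, T], but predictability only speaks of
    positive times. *)
Lemma closed_slab_integral (f : R -> Om -> R) :
  measurable_fun (`]0, T] `*` [set: Om]) (fun p : R * Om => f p.1 p.2) ->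
  (\int[P]_w \int[lebesgue_measure]_(t in `[0%R, T]) (f t w)%:E =
   \int[P]_w \int[lebesgue_measure]_(t in `]0%R, T]) (f t w)%:E)%E.
Proof.
move=> /measurable_EFinP mf; apply: eq_integral => w _.
rewrite integral_itv_obnd_cbnd//.
exact: (slab_measurable_path (measurable_itv _) mf w).
Qed.

Lemma slab_integralZl (k : R) (f : R -> Om -> R) : 0 <= k ->
  measurable_fun (`]0, T] `*` [set: Om]) (fun p : R * Om => f p.1 p.2) ->
  (forall t w, 0 <= f t w) ->
  (\int[P]_w \int[lebesgue_measure]_(t in `]0%R, T]) (k * f t w)%:E =
   k%:E * \int[P]_w \int[lebesgue_measure]_(t in `]0%R, T]) (f t w)%:E)%E.
Proof.
move=> k0 /measurable_EFinP mf f0.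
rewrite -ge0_integralZl//; last 2 first.
- apply: (slab_measurable_integral (measurable_itv _) mf) => p _.
  by rewrite lee_fin.
- by move=> w _; apply: integral_ge0 => t _; rewrite lee_fin.
apply: eq_integral => w _; rewrite -ge0_integralZl//.
- exact: (slab_measurable_path (measurable_itv _) mf w).
- by move=> t _; rewrite lee_fin.
Qed.

Lemma slab_integralD (f h : R -> Om -> R) :
  measurable_fun (`]0, T] `*` [set: Om]) (fun p : R * Om => f p.1 p.2) ->
  (forall t w, 0 <= f t w) ->
  measurable_fun (`]0, T] `*` [set: Om]) (fun p : R * Om => h p.1 p.2) ->
  (forall t w, 0 <= h t w) ->
  (\int[P]_w \int[lebesgue_measure]_(t in `]0%R, T]) (f t w + h t w)%:E =
   \int[P]_w \int[lebesgue_measure]_(t in `]0%R, T]) (f t w)%:E +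
   \int[P]_w \int[lebesgue_measure]_(t in `]0%R, T]) (h t w)%:E)%E.
Proof.
move=> /measurable_EFinP mf f0 /measurable_EFinP mh h0.
rewrite -ge0_integralD//; last 4 first.
- by move=> w _; apply: integral_ge0 => t _; rewrite lee_fin.
- apply: (slab_measurable_integral (measurable_itv _) mf) => p _.
  by rewrite lee_fin.
- by move=> w _; apply: integral_ge0 => t _; rewrite lee_fin.
- apply: (slab_measurable_integral (measurable_itv _) mh) => p _.
  by rewrite lee_fin.
apply: eq_integral => w _; rewrite -ge0_integralD//.
- by move=> t _; rewrite lee_fin.
- exact: (slab_measurable_path (measurable_itv _) mf w).
- by move=> t _; rewrite lee_fin.
- exact: (slab_measurable_path (measurable_itv _) mh w).
Qed.

Lemma slab_le_integral (f h : R -> Om -> R) :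
  (forall t w, 0 <= f t w) -> (forall t w, f t w <= h t w) ->
  (\int[P]_w \int[lebesgue_measure]_(t in `]0%R, T]) (f t w)%:E <=
   \int[P]_w \int[lebesgue_measure]_(t in `]0%R, T]) (h t w)%:E)%E.
Proof.
move=> f0 fh; apply: ge0_le_integral_lower => w _.
  by apply: integral_ge0 => t _; rewrite lee_fin.
by apply: ge0_le_integral_lower => t _; rewrite lee_fin.
Qed.

Lemma slab_integral_ge0 (f : R -> Om -> R) : (forall t w, 0 <= f t w) ->
  (0 <= \int[P]_w \int[lebesgue_measure]_(t in `]0%R, T]) (f t w)%:E)%E.
Proof.
by move=> f0; apply: integral_ge0 => w _; apply: integral_ge0 => t _; rewrite lee_fin.
Qed.

Let a := (\int[P]_w \int[lebesgue_measure]_(t in `]0%R, T]) ((lam t w)^-1)%:E)%E.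

Lemma expected_inverse_intensity_fin : a \is a fin_num.
Proof.
rewrite ge0_fin_numE; last by apply: slab_integral_ge0 => t w; rewrite invr_ge0 ltW.
apply: (@le_lt_trans _ _ (mu^-1 * T)%:E); last exact: ltry.
rewrite -(slab_integral_cst P (ltW T0)); apply: slab_le_integral => t w.
  by rewrite invr_ge0 ltW.
by rewrite lef_pV2 ?posrE// (intensity_ge N mu g0 rho0).
Qed.

Lemma expected_scaled_inverse (k : R) : 0 <= k ->
  (\int[P]_w \int[lebesgue_measure]_(t in `[0%R, T]) (k / lam t w)%:E =
   k%:E * \int[P]_w \int[lebesgue_measure]_(t in `]0%R, T]) ((lam t w)^-1)%:E)%E.
Proof.
move=> k0; rewrite closed_slab_integral.
  apply: slab_integralZl => //; first exact: measurable_intensity_inv.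
  by move=> t w; rewrite invr_ge0 ltW.
by apply: measurable_funM => //; exact: measurable_intensity_inv.
Qed.

Lemma fisher00E : fisher_information P g mu rho N T 0 0 = mu ^+ 2 * fine a.
Proof.
rewrite fisher_informationE/= expected_scaled_inverse ?mulr_ge0 ?ltW//.
by rewrite fineM ?expected_inverse_intensity_fin// expr2.
Qed.

(** The integrand is - (1 - rho) * mu / rho * (1 - mu / lambda), and
    0 < mu / lambda <= 1. *)
Lemma fisher01_le : `|fisher_information P g mu rho N T 0 1| <= (1 - rho) * mu * T / rho.
Proof.
rewrite fisher_informationE/=.
have f0 t w : 0 <= (1 - rho) * mu / rho * (1 - mu / lam t w).
  have : mu / lam t w <= 1 by rewrite ler_pdivrMr ?mul1r// (intensity_ge N mu g0 rho0).
  by move=> ?; rewrite !mulr_ge0 ?subr_ge0 ?invr_ge0 ?(ltW mu0) ?(ltW rho0) ?(ltW rho1).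
under eq_integral => w _.
  under eq_integral => t _.
    rewrite (_ : (_ / _) = - ((1 - rho) * mu / rho * (1 - mu / lam t w))); last first.
      by field; rewrite !gt_eqF.
    rewrite EFinN; over.
  rewrite integral_ge0N; last first.
    by move=> t _; rewrite lee_fin.
  over.
rewrite integral_ge0N; last first.
  by move=> w _; apply: integral_ge0 => t _; rewrite lee_fin.
rewrite closed_slab_integral; last first.
  apply: measurable_funM => //; apply: measurable_funB => //.
  by apply: measurable_funM => //; exact: measurable_intensity_inv.
set Z := (\int[P]_w _)%E.
have Z0 : (0 <= Z)%E by exact: slab_integral_ge0.
have Zle : (Z <= ((1 - rho) * mu * T / rho)%:E)%E.
  rewrite (_ : (1 - rho) * mu * T / rho = ((1 - rho) * mu / rho) * T); last by ring.
  rewrite -(slab_integral_cst P (ltW T0)); apply: slab_le_integral => // t w.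
  apply: ler_piMr; last by rewrite gerBl divr_ge0// ltW.
  by rewrite !mulr_ge0 ?subr_ge0 ?invr_ge0 ?(ltW mu0) ?(ltW rho0) ?(ltW rho1).
have Zfin : Z \is a fin_num by rewrite ge0_fin_numE// (le_lt_trans Zle)// ltry.
by rewrite fineN normrN ger0_norm ?fine_ge0// -lee_fin fineK.
Qed.

Let L := (\int[P]_w \int[lebesgue_measure]_(t in `]0%R, T]) (lam t w)%:E)%E.

Let score_eta t w := ((1 - rho) * ((lam t w - mu) / rho)) ^+ 2 / lam t w.

Let score_eta_ge0 t w : 0 <= score_eta t w.
Proof. by rewrite divr_ge0 ?sqr_ge0// ltW. Qed.

Let measurable_score_eta : measurable_fun (`]0, T] `*` [set: Om])
  (fun p : R * Om => score_eta p.1 p.2).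
Proof.
apply: measurable_funM; last exact: measurable_intensity_inv.
apply: measurable_funX; apply: measurable_funM => //.
by apply: measurable_funM => //; exact: measurable_funB.
Qed.

Let fisher11E : fisher_information P g mu rho N T 1 1 =
  fine (\int[P]_w \int[lebesgue_measure]_(t in `]0%R, T]) (score_eta t w)%:E)%E.
Proof.
rewrite fisher_informationE/= -(closed_slab_integral measurable_score_eta).
congr fine; apply: eq_integral => w _; apply: eq_integral => t _.
by rewrite /score_eta expr2 mulNr mulrNN.
Qed.

Hypothesis L_fin : L \is a fin_num.

Let k : R := ((1 - rho) / rho) ^+ 2.

Let score_eta_le t w : score_eta t w <= k * lam t w.
Proof.
rewrite /score_eta ler_pdivrMr// -mulrA -expr2 /k -exprMn.
rewrite ler_pXn2r ?nnegrE//.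
- rewrite mulrA mulrAC ler_wpM2l ?gerBl ?(ltW mu0)//.
  by rewrite divr_ge0 ?subr_ge0 ?(ltW rho0) ?(ltW rho1).
- rewrite !mulr_ge0 ?invr_ge0 ?subr_ge0 ?(ltW rho0) ?(ltW rho1)//.
  exact: intensity_ge.
- by rewrite !mulr_ge0 ?invr_ge0 ?subr_ge0 ?(ltW rho0) ?(ltW rho1)// ltW.
Qed.

Let k0 : 0 <= k. Proof. exact: sqr_ge0. Qed.

Let score_eta_integral_le :
  (\int[P]_w \int[lebesgue_measure]_(t in `]0%R, T]) (score_eta t w)%:E <=
   k%:E * L)%E.
Proof.
rewrite -slab_integralZl//; last by move=> t w; exact: ltW.
exact: slab_le_integral.
Qed.

Let score_eta_fin :
  (\int[P]_w \int[lebesgue_measure]_(t in `]0%R, T]) (score_eta t w)%:E)%E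
  \is a fin_num.
Proof.
rewrite ge0_fin_numE; last exact: slab_integral_ge0.
by apply: le_lt_trans score_eta_integral_le _; rewrite -(fineK L_fin) -EFinM ltry.
Qed.

(** From (lambda - mu)^2 <= lambda^2, as 0 <= lambda - mu <= lambda. *)
Lemma fisher11_le : fisher_information P g mu rho N T 1 1 <= k * fine L.
Proof.
by rewrite fisher11E -lee_fin fineK// EFinM fineK.
Qed.

(** From (lambda - mu)^2 / lambda + 2 mu = lambda + mu^2 / lambda >= lambda, stated
    additively so that only non-negative functions are integrated. *)
Lemma fisher11_ge :
  k * (fine L - 2 * mu * T) <= fisher_information P g mu rho N T 1 1.
Proof.
rewrite fisher11E mulrBr lerBlDr -lee_fin EFinD fineK// EFinM fineK//.
have kmu : 0 <= k * (2 * mu) by rewrite mulr_ge0// mulr_ge0// ltW.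
rewrite (mulrA k) -(slab_integral_cst P (ltW T0)) -slab_integralD//.
rewrite -slab_integralZl//; last by move=> t w; exact: ltW.
apply: slab_le_integral => t w; first by rewrite mulr_ge0// ltW.
have -> : score_eta t w + k * (2 * mu) = k * (lam t w + mu ^+ 2 / lam t w).
  by rewrite /score_eta /k; field; rewrite !gt_eqF.
by rewrite ler_wpM2l// lerDl divr_ge0 ?sqr_ge0// ltW.
Qed.

End horizon.

End fisher.

(** * Divergence of mean inverses under convergence in law to an atom at 0 *)

Lemma gt_limn_einf_near (R : realType) (u : (\bar R)^nat) (M : \bar R) :
  (M < limn_einf u)%E -> \forall n \near \oo, (M < u n)%E.
Proof.
rewrite limn_einf_lim => Mu.
have [n Mn] : exists n, (M < einfs u n)%E.
  apply: contrapT => /forallNP h; move: Mu; rewrite ltNge => /negP; apply.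
  apply: lime_le; first exact: is_cvg_einfs.
  by apply: nearW => n; rewrite leNgt; apply/negP; exact: h.
exists n => // m /= nm; apply: (lt_le_trans Mn); apply: ereal_inf_lbound.
by exists m.
Qed.

Section damped_inverse.
Context (R : realType) (e : R).
Hypothesis e0 : 0 < e.

(** A bounded continuous minorant of the inverse on positive reals, increasing to
    it as e tends to 0; convergence in law does not apply to the inverse. *)
Definition damped_inverse (x : R) : R := (`|x| + e)^-1.

Let den_gt0 (x : R) : 0 < `|x| + e.
Proof. by rewrite ltr_wpDl. Qed.

Lemma damped_inverse_ge0 x : 0 <= damped_inverse x.
Proof. by rewrite invr_ge0 ltW. Qed.

Lemma damped_inverse0 : damped_inverse 0 = e^-1.
Proof. by rewrite /damped_inverse normr0 add0r. Qed.

Lemma damped_inverse_le x : damped_inverse x <= e^-1.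
Proof. by rewrite lef_pV2 ?posrE// lerDr. Qed.

Lemma damped_inverse_le_inv x : 0 < x -> damped_inverse x <= x^-1.
Proof. by move=> x0; rewrite lef_pV2 ?posrE// gtr0_norm// lerDl ltW. Qed.

Lemma continuous_damped_inverse : continuous damped_inverse.
Proof.
move=> x; apply: cvgV; first by rewrite gt_eqF.
by apply: cvgD; [exact: norm_continuous|exact: cvg_cst].
Qed.

Lemma measurable_damped_inverse : measurable_fun [set: R] damped_inverse.
Proof. apply: continuous_measurable_fun; exact: continuous_damped_inverse. Qed.

End damped_inverse.

Lemma measurable_atom d (Om : measurableType d) (R : realType)
    (Q : probability Om R) (V : {RV Q >-> R}) (x : R) :
  measurable [set w | V w = x].
Proof.
by rewrite (_ : [set w | _] = V @^-1` [set x]).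
Qed.

(** On the event V = 0 the damped inverse takes its maximal value e^-1. *)
Lemma damped_inverse_atom d (Om : measurableType d) (R : realType)
    (Q : probability Om R) (V : {RV Q >-> R}) (e : R) : 0 < e ->
  (e^-1%:E * Q [set w | V w = 0%R] <= \int[Q]_w (damped_inverse e (V w))%:E)%E.
Proof.
move=> e0.
have mA := measurable_atom V 0.
have -> : Q [set w | V w = 0] =
    (\int[Q]_w (\1_[set w | V w = 0%R] w)%:E)%E by rewrite integral_indic// setIT.
rewrite -ge0_integralZl//; last 2 first.
- by apply/measurable_EFinP; exact: measurable_indic.
- by rewrite lee_fin invr_ge0 ltW.
apply: ge0_le_integral_lower => w _.
  by rewrite -EFinM lee_fin mulr_ge0// invr_ge0 ltW.
rewrite -EFinM lee_fin indicE; case: (boolP (w \in _)) => [|_]; rewrite ?inE /=.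
  by move=> ->; rewrite mulr1 damped_inverse0.
by rewrite mulr0 damped_inverse_ge0.
Qed.

(** By Fatou's lemma in u, liminf A >= e^-1 * int_0^1 Q_u (V u = 0) du for all
    e > 0.  The probability of V u = 0 need not be measurable in u, since the V u
    live on unrelated spaces: it is replaced by a measurable
    minorant h with positive integral c.  Limits along the reals are tested on
    sequences, where Fatou's lemma is available. *)
Lemma expected_inverse_diverges (R : realType)
    (d : R -> measure_display) (Om : forall T : R, measurableType (d T))
    (P : forall T : R, probability (Om T) R)
    (X : forall T : R, R -> Om T -> R)
    (dV : R -> measure_display) (OmV : forall u : R, measurableType (dV u))
    (Q : forall u : R, probability (OmV u) R)
    (V : forall u : R, {RV (Q u) >-> R}) (A : R -> \bar R) :
  {ae lebesgue_measure, forall u : R, 0 < u <= 1 ->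
      cvg_in_law P (fun T w => X T u w) (Q u) (V u)} ->
  (0 < \int[lebesgue_measure]_(u in `]0%R, 1%R])
                    Q u [set w | V u w = 0%R])%E ->
  (\forall T \near +oo%R, forall e, 0 < e ->
    measurable_fun `](0 : R), 1] (fun u => \int[P T]_w (damped_inverse e (X T u w))%:E)%E /\
    (\int[lebesgue_measure]_(u in `]0%R, 1%R])
       \int[P T]_w (damped_inverse e (X T u w))%:E <= A T)%E) ->
  A T @[T --> +oo%R] --> +oo%E.
Proof.
move=> Xlaw /integral_lower_witness[|h [mh h0 hQ hpos]].
  by move=> u _; exact: measure_ge0.
set c := (\int[lebesgue_measure]_(u in _) h u)%E in hpos.
move=> nearA; apply/cvge_pinftyP => a aoo; apply/cvgeyPge => M.
have [n0 _ {}nearA] : \forall n \near \oo, forall e, 0 < e ->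
    measurable_fun `](0 : R), 1]
      (fun u => \int[P (a n)]_w (damped_inverse e (X (a n) u w))%:E)%E /\
    (\int[lebesgue_measure]_(u in `]0%R, 1%R])
       \int[P (a n)]_w (damped_inverse e (X (a n) u w))%:E <= A (a n))%E.
  exact: aoo nearA.
pose b n := a (n + n0)%N.
have boo : b n @[n --> \oo] --> +oo by rewrite cvg_shiftn.
have {}nearA n := nearA (n + n0)%N (leq_addl _ _).
suff : \forall n \near \oo, (M%:E <= A (b n))%E.
  move=> [n1 _ hn1]; exists (n1 + n0)%N => // n /= n10n.
  have := hn1 (n - n0)%N; rewrite /b subnK ?(leq_trans (leq_addl _ _) n10n)//.
  by apply; rewrite /= leq_subRL ?(leq_trans (leq_addl _ _) n10n)// addnC.
(* Any e < c / M would do; |M| + 1 also covers M <= 0. *)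
have [e e0 Me] : exists2 e : R, 0 < e & (M%:E < e^-1%:E * c)%E.
  have c1 : (c <= 1)%E.
    apply: (@le_trans _ _ (\int[lebesgue_measure]_(u in `]0%R, 1%R]) 1%:E)%E).
      apply: ge0_le_integral_lower => // u u01.
      apply: le_trans (hQ u u01) _; apply: probability_le1; exact: measurable_atom.
    rewrite integral_cst//= lebesgue_measure_itv/= lte_fin ltr01.
    by rewrite oppr0 adde0 mule1.
  have cfin : c \is a fin_num by rewrite ge0_fin_numE ?(ltW hpos)// (le_lt_trans c1)// ltry.
  move: hpos; rewrite -(fineK cfin) lte_fin => c0.
  exists (fine c / (`|M| + 1)); first by rewrite divr_gt0// ltr_wpDl.
  rewrite -EFinM lte_fin invf_div divfK ?gt_eqF//.
  by rewrite (le_lt_trans (ler_norm M))// ltrDl.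
pose phi n u := (\int[P (b n)]_w (damped_inverse e (X (b n) u w))%:E)%E.
have mphi n : measurable_fun `](0 : R), 1] (phi n) := (nearA n e e0).1.
have phi0 n u : (0 <= phi n u)%E.
  by apply: integral_ge0 => w _; rewrite lee_fin damped_inverse_ge0.
have mliminf : measurable_fun `](0 : R), 1] (fun u => limn_einf (phi^~ u)).
  apply: measurableT_comp => //.
  apply: measurable_fun_limn_esup => n.
  exact: measurableT_comp.
have liminf0 u : (0 <= limn_einf (phi^~ u))%E.
  rewrite limn_einf_lim; apply: lime_ge; first exact: is_cvg_einfs.
  by apply: nearW => n; apply: le_ereal_inf_tmp => _ [k _ <-].
have fatou_phi : (e^-1%:E * c <= limn_einf (fun n =>
    \int[lebesgue_measure]_(u in `]0%R, 1%R]) phi n u))%E.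
  apply: (@le_trans _ _ (\int[lebesgue_measure]_(u in `]0%R, 1%R])
      limn_einf (phi^~ u))%E).
    rewrite /c -ge0_integralZl//; last 2 first.
    - exact: measurable_funTS.
    - by rewrite lee_fin invr_ge0 ltW.
    apply: ae_ge0_le_integral => //.
    - by move=> u _; rewrite mule_ge0// lee_fin invr_ge0 ltW.
    - by apply: measurable_funeM; exact: measurable_funTS.
    - move: Xlaw => [Z [mZ Z0 XZ]]; exists Z; split => // u /= notle.
      apply: XZ => /= Xlaw; apply: notle => u01.
      have u01' : 0 < u <= 1 by move: u01; rewrite /= in_itv.
      have phicvg : phi n u @[n --> \oo] -->
          (\int[Q u]_w (damped_inverse e (V u w))%:E)%E.
        have := Xlaw u01' _ (continuous_damped_inverse e0).
        have bd : exists M, forall x : R, `|damped_inverse e x| <= M.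
          exists e^-1 => x; rewrite ger0_norm ?damped_inverse_ge0//.
          exact: damped_inverse_le.
        by move=> /(_ bd)/cvge_pinftyP/(_ _ boo).
      rewrite (cvg_limn_einf_sup phicvg).1.
      apply: le_trans (damped_inverse_atom (V u) e0).
      by rewrite lee_wpmul2l ?hQ// lee_fin invr_ge0 ltW.
  exact: fatou.
have := gt_limn_einf_near (lt_le_trans Me fatou_phi).
apply: filterS => n /ltW Mphi; exact: le_trans Mphi (nearA n e e0).2.
Qed.

(** * Nearly unstable asymptotics *)

(** With b = lambda_bar the right-hand side is A_T: Tonelli's theorem and the
    dilation t = u T bring it to the form required by expected_inverse_diverges.
    The intensity is at least mu > 0, so its inverse dominates the damped one. *)
Lemma hawkes_damped_le d (Om : measurableType d) (R : realType)
    (P : probability Om R) (N : R.-ker Om ~> measurableTypeR R)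
    (g : R -> R) (mu rho T b e : R) :
  (forall t, 0 <= g t) -> 0 < mu -> 0 < rho -> hawkes_process P g mu rho N ->
  0 < T -> 0 < b -> 0 < e ->
  measurable_fun `](0 : R), 1] (fun u => \int[P]_w
    (damped_inverse e (hawkes_intensity g mu rho (N w) (u * T) / b))%:E)%E /\
  (\int[lebesgue_measure]_(u in `]0%R, 1%R]) \int[P]_w
     (damped_inverse e (hawkes_intensity g mu rho (N w) (u * T) / b))%:E <=
   T^-1%:E * \int[P]_w \int[lebesgue_measure]_(t in `[0%R, T])
     (b / hawkes_intensity g mu rho (N w) t)%:E)%E.
Proof.
move=> g0 mu0 rho0 hN T0 b0 e0.
pose lam t w := hawkes_intensity g mu rho (N w) t.
have lam0 t w : 0 < lam t w by exact: lt_le_trans mu0 (intensity_ge N mu g0 rho0 t w).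
pose f (p : R * Om) := (damped_inverse e (lam p.1 p.2 / b))%:E.
have mf : measurable_fun (`]0, T] `*` [set: Om]) f.
  apply/measurable_EFinP; apply: (measurableT_comp (measurable_damped_inverse e0)).
  by apply: measurable_funM => //; exact: (measurable_intensity (T := T) hN).
have f0 (p : R * Om) : (`]0, T] `*` [set: Om]) p -> (0 <= f p)%E.
  by move=> _; rewrite lee_fin damped_inverse_ge0.
pose phi t := (\int[P]_w f (t, w))%E.
have phi0 t : (0 <= phi t)%E.
  by apply: integral_ge0 => w _; rewrite lee_fin damped_inverse_ge0.
have mphi : measurable_fun `]0, T] phi.
  exact: (slab_measurable_expectation P (measurable_itv _) mf f0).
split.
  apply: (@measurable_comp _ _ _ _ _ _ `]0, T]%classic phi _ (fun u : R => u * T)) => //.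
  - move=> _ [u /= + <-]; rewrite !in_itv/= => /andP[u0 u1].
    by rewrite mulr_gt0//= ger_pMl.
  - exact: measurable_funM.
rewrite closed_slab_integral//; last first.
  by apply: measurable_funM => //; exact: measurable_intensity_inv hN _.
apply: (@le_trans _ _ (T^-1%:E * \int[lebesgue_measure]_(t in `]0%R, T]) phi t)%E).
  rewrite (ge0_integral_dilation T0 mphi)// muleA -EFinM mulVf ?gt_eqF//.
  by rewrite mul1e.
rewrite lee_wpmul2l// ?lee_fin ?invr_ge0 ?(ltW T0)//.
rewrite -(slab_fubini_tonelli P (measurable_itv _) mf f0).
apply: (@slab_le_integral _ _ _ P T (fun t w => damped_inverse e (lam t w / b))).
  by move=> t w; exact: damped_inverse_ge0.
move=> t w; rewrite -[leRHS]invf_div; apply: damped_inverse_le_inv => //.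
exact: divr_gt0.
Qed.

Lemma powR_near_ge (R : realType) (a M : R) : 0 < a ->
  \forall T \near +oo, M <= T `^ a.
Proof.
move=> a0; near=> T.
have M1 : 0 < Num.max M 1 by rewrite lt_max ltr01 orbT.
apply: (@le_trans _ _ (Num.max M 1)); first by rewrite le_max lexx.
have MT : (Num.max M 1) `^ a^-1 <= T.
  by near: T; apply: nbhs_pinfty_ge; exact: num_real.
rewrite -[leLHS](@powRr1 _ (Num.max M 1)) ?(ltW M1)//.
rewrite -(@mulVf _ a) ?gt_eqF// powRrM.
apply: ge0_ler_powR => //; first exact: ltW.
- by rewrite nnegrE powR_ge0.
- by rewrite nnegrE (le_trans (powR_ge0 _ _) MT).
Unshelve. all: by end_near. Qed.

(* Everything is expressed through x = T ^ gamma: 1 - rho = lam_star / x and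
   mu = mu_star * x / T, so that the comparisons below are rational in x and T. *)
Section nearly_unstable.
Context (R : realType) (gamma lam_star mu_star : R).
Hypothesis gamma01 : 0 < gamma < 1.
Hypothesis lam0 : 0 < lam_star.
Hypothesis mu0 : 0 < mu_star.
Variables (T : R) (T0 : 0 < T) (stable : lam_star * T `^ (- gamma) < 1).

Let x := T `^ gamma.

Let x0 : 0 < x. Proof. exact: powR_gt0. Qed.

Let rho := rho_ gamma lam_star T.
Let mu := mu_ gamma mu_star T.

Lemma one_minus_rhoE : 1 - rho_ gamma lam_star T = lam_star / T `^ gamma.
Proof. by rewrite /rho_ powRN opprB addrC subrK. Qed.

Lemma muE : mu_ gamma mu_star T = mu_star * T `^ gamma / T.
Proof.
rewrite /mu_ powRB; last by rewrite (gt_eqF T0) implybT.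
by rewrite powRr1 ?(ltW T0)// mulrA.
Qed.

Lemma rho_gt0 : 0 < rho_ gamma lam_star T.
Proof. by rewrite /rho_ subr_gt0. Qed.

Lemma rho_lt1 : rho_ gamma lam_star T < 1.
Proof. by rewrite -subr_gt0 one_minus_rhoE divr_gt0. Qed.

Lemma mu_gt0 : 0 < mu_ gamma mu_star T.
Proof. by rewrite muE !mulr_gt0// invr_gt0. Qed.

Lemma lambda_bar_gt0 : 0 < lambda_bar gamma lam_star mu_star T.
Proof. by rewrite divr_gt0 ?mu_gt0// subr_gt0 rho_lt1. Qed.

Section process.
Context d (Om : measurableType d) (P : probability Om R).
Variable N : R.-ker Om ~> measurableTypeR R.
Hypothesis hN : hawkes_process P (heavy_kernel gamma) (mu_ gamma mu_star T)
  (rho_ gamma lam_star T) N.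

Let J := fisher_ P gamma lam_star mu_star T N.

Let g0 := heavy_kernel_ge0 gamma01.
Let gB := heavy_kernel_le gamma01.
Let mg := measurable_heavy_kernel gamma.
Let g1 := @integral_heavy_kernel_le1 R gamma.

Let L := (\int[P]_w \int[lebesgue_measure]_(t in `]0%R, T])
  (hawkes_intensity (heavy_kernel gamma) mu rho (N w) t)%:E)%E.

Let L_ge0 : (0 <= L)%E.
Proof.
apply: slab_integral_ge0 => t w.
exact: le_trans (ltW mu_gt0) (intensity_ge N _ g0 rho_gt0 t w).
Qed.

Let L_le : (L <= (mu * T / (1 - rho))%:E)%E.
Proof.
exact: (expected_intensity_le mg g0 gB g1 mu_gt0 rho_gt0 rho_lt1 hN (ltW T0)).
Qed.

Let L_fin : L \is a fin_num.
Proof. by rewrite ge0_fin_numE// (le_lt_trans L_le)// ltry. Qed.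

Lemma A_fin : A_ P gamma lam_star mu_star T N \is a fin_num.
Proof.
rewrite /A_ /lambda_ (expected_scaled_inverse g0 mu_gt0 rho_gt0 hN); last first.
  exact/ltW/lambda_bar_gt0.
have := expected_inverse_intensity_fin P N g0 mu_gt0 rho_gt0 T0.
by move=> /fineK <-.
Qed.

(** mu^2 / (lambda_bar / T) = mu * T * (1 - rho) does not depend on T: the
    scalings of mu and 1 - rho are tuned so that it equals mu_star * lam_star. *)
Lemma fisher_log_muE :
  J 0 0 = mu_star * lam_star * fine (A_ P gamma lam_star mu_star T N).
Proof.
rewrite /J /fisher_ (fisher00E g0 mu_gt0 rho_gt0 rho_lt1 hN T0).
rewrite /A_ /lambda_ (expected_scaled_inverse g0 mu_gt0 rho_gt0 hN); last first.
  exact/ltW/lambda_bar_gt0.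
have /fineK <- := expected_inverse_intensity_fin P N g0 mu_gt0 rho_gt0 T0.
rewrite -!EFinM /= /lambda_bar one_minus_rhoE muE -/x.
by field; rewrite !gt_eqF.
Qed.

Lemma fisher_log_mu_ge0 : 0 <= J 0 0.
Proof.
rewrite /J /fisher_ (fisher00E g0 mu_gt0 rho_gt0 rho_lt1 hN T0) mulr_ge0 ?sqr_ge0//.
apply/fine_ge0/slab_integral_ge0 => t w; rewrite invr_ge0.
exact: le_trans (ltW mu_gt0) (intensity_ge N _ g0 rho_gt0 t w).
Qed.

(** Nuisance parameters can only decrease the information, so J_11 is an upper
    bound; it is then controlled by the mean number of points. *)
Lemma efficient_log_one_minus_rho_le :
  efficient_log_one_minus_rho J <=
  mu_star * lam_star / rho_ gamma lam_star T ^+ 2.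
Proof.
apply: (@le_trans _ _ (J 1 1)).
  by rewrite /efficient_log_one_minus_rho gerBl divr_ge0 ?sqr_ge0 ?fisher_log_mu_ge0.
have := fisher11_le g0 mu_gt0 rho_gt0 rho_lt1 hN L_fin.
rewrite -/J => /le_trans; apply.
have Lr : fine L <= mu * T / (1 - rho) by rewrite -lee_fin fineK.
apply: le_trans (ler_wpM2l (sqr_ge0 _) Lr) _.
rewrite le_eqVlt; apply/orP; left; apply/eqP.
rewrite expr_div_n -/rho /rho one_minus_rhoE /mu muE -/x.
by have := rho_gt0 => ?; field; rewrite !gt_eqF.
Qed.

(* The constant comes from solving
   mu_star * x * T / 2 <= (lam_star + 2 / (1 - gamma)) * (T / x) * L for L. *)
Let c := mu_star / (2 * (lam_star + 2 / (1 - gamma))).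

Let gamma_lt1 : 0 < 1 - gamma.
Proof. by case/andP: gamma01 => _; rewrite subr_gt0. Qed.

Let den0 : 0 < lam_star + 2 / (1 - gamma).
Proof. by rewrite addr_gt0// divr_gt0. Qed.

(** In expected_intensity_ge both (1 - rho) * T and K are at most a constant times
    T / x = T ^ (1 - gamma), so that L is at least of the order of its upper
    bound mu * T / (1 - rho). *)
Lemma expected_count_ge : 1 <= T -> c * x ^+ 2 <= fine L.
Proof.
move=> T1.
pose K := (1 + T) `^ (1 - gamma) / (1 - gamma).
have K0 : 0 <= K by rewrite divr_ge0 ?powR_ge0// ltW.
have hK s : 0 < s <= T -> ((T - s - K)%:E <=
    \int[lebesgue_measure]_(t in `]s, T]) ((T - t) * heavy_kernel gamma (t - s))%:E)%E.
  move=> /andP[s0 sT]; apply: le_trans (integral_heavy_kernel_linear_ge gamma01 sT).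
  rewrite lee_fin lerD2l lerN2 /K ler_wpM2r ?invr_ge0 ?(ltW gamma_lt1)//.
  apply: ge0_ler_powR; rewrite ?nnegrE ?(ltW gamma_lt1)//; first last.
  - by rewrite lerD2l lerBlDr lerDl ltW.
  - by rewrite addr_ge0// ltW.
  - by rewrite addr_ge0// subr_ge0.
have := expected_intensity_ge mg g0 gB g1 mu_gt0 rho_gt0 rho_lt1 hN T0 K0 hK.
rewrite -/L one_minus_rhoE muE -/x => LK.
have KT : K <= 2 / (1 - gamma) * (T / x).
  rewrite /K mulrAC ler_wpM2r ?invr_ge0 ?(ltW gamma_lt1)//.
  have -> : T / x = T `^ (1 - gamma).
    rewrite powRB; last by rewrite (gt_eqF T0) implybT.
    by rewrite powRr1// ltW.
  (* As T >= 1, 1 + T <= 2 T, and 2 ^ (1 - gamma) <= 2. *)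
  apply: (@le_trans _ _ ((2 * T) `^ (1 - gamma))).
    apply: ge0_ler_powR; rewrite ?nnegrE ?(ltW gamma_lt1)//.
    - by rewrite addr_ge0// ltW.
    - by rewrite mulr_ge0// ltW.
    - by rewrite mulr2n mulrDl mul1r lerD2r.
  rewrite powRM ?(ltW T0)// ler_wpM2r ?powR_ge0//.
  rewrite ler1_powR ?ler1n// gerBl.
  by case/andP: gamma01 => /ltW.
have Lr0 : 0 <= fine L by rewrite fine_ge0.
have {}LK : mu_star * x * T / 2 <= (lam_star + 2 / (1 - gamma)) * (T / x) * fine L.
  rewrite (_ : mu_star * x * T / 2 = mu_star * x / T * T ^+ 2 / 2); last first.
    by field; rewrite gt_eqF.
  apply: (le_trans LK); rewrite ler_wpM2r// mulrDl mulrAC lerD//.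
  by rewrite mulrA.
rewrite /c mulrAC ler_pdivrMr ?mulr_gt0//.
have xT : 0 < 2 * x / T by rewrite divr_gt0 ?mulr_gt0.
rewrite -(ler_pM2r xT) in LK.
rewrite (_ : mu_star * x ^+ 2 = mu_star * x * T / 2 * (2 * x / T)); last first.
  by field; rewrite gt_eqF.
apply: (le_trans LK); rewrite le_eqVlt; apply/orP; left; apply/eqP.
by field; rewrite !gt_eqF.
Qed.

(** The threshold on x makes 2 * mu * T = 2 * mu_star * x at most half of
    c * x ^+ 2, hence of L; the factor ((1 - rho) / rho)^2 cancels in the
    quotient, and so does x ^+ 2. *)
Lemma information_loss_le : 1 <= T -> 4 * mu_star / c <= x ->
  J 0 1 ^+ 2 / J 1 1 <= 2 * mu_star ^+ 2 / c.
Proof.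
move=> T1 cx; have Lc := expected_count_ge T1.
have c0 : 0 < c by rewrite divr_gt0// mulr_gt0.
have muT : mu * T = mu_star * x by rewrite /mu muE -/x divfK// gt_eqF.
have rho0 : 0 < rho := rho_gt0.
have m0 : 0 < mu := mu_gt0.
have q0 : 0 < 1 - rho by rewrite subr_gt0 rho_lt1.
have J11 := fisher11_ge g0 mu_gt0 rho_gt0 rho_lt1 hN T0 L_fin.
have J01 := fisher01_le g0 mu_gt0 rho_gt0 rho_lt1 hN T0.
rewrite -/J in J11, J01.
have Lx : c * x ^+ 2 / 2 <= fine L - 2 * mu * T.
  rewrite -(mulrA 2) muT.
  have : 4 * mu_star * x <= c * x ^+ 2.
    by rewrite expr2 mulrA ler_wpM2r ?(ltW x0)// (mulrC c) -ler_pdivrMr.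
  by move: Lc; lra.
set k := ((1 - rho) / rho) ^+ 2.
have k0 : 0 < k by rewrite exprn_gt0// divr_gt0.
have D0 : 0 < k * (c * x ^+ 2 / 2).
  by rewrite mulr_gt0// divr_gt0// mulr_gt0// exprn_gt0.
have J11' : k * (c * x ^+ 2 / 2) <= J 1 1.
  by apply: le_trans J11; rewrite ler_wpM2l// ltW.
have J11_gt0 := lt_le_trans D0 J11'.
have J01' : J 0 1 ^+ 2 <= k * (mu_star * x) ^+ 2.
  rewrite -(@real_normK _ (J 0 1)) ?num_real// -muT.
  rewrite (_ : k * (mu * T) ^+ 2 = ((1 - rho) * mu * T / rho) ^+ 2); last first.
    by rewrite /k; field; rewrite gt_eqF.
  rewrite ler_pXn2r ?nnegrE//.
  apply: divr_ge0; last exact: ltW.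
  by apply: mulr_ge0; [apply: mulr_ge0|]; exact: ltW.
rewrite ler_pdivrMr//; apply: (le_trans J01').
rewrite (_ : k * (mu_star * x) ^+ 2 =
  2 * mu_star ^+ 2 / c * (k * (c * x ^+ 2 / 2))); last first.
  by field; rewrite gt_eqF.
by rewrite ler_wpM2l// divr_ge0 ?(ltW c0)// mulr_ge0// sqr_ge0.
Qed.

End process.

End nearly_unstable.

Theorem proposition4p3 (R : realType) (gamma lam_star mu_star : R)
    (hgamma : 2^-1 < gamma < 1) (hlam : 0 < lam_star) (hmu : 0 < mu_star)
    (d : R -> measure_display) (Om : forall T : R, measurableType (d T))
    (P : forall T : R, probability (Om T) R)
    (N : forall T : R, R.-ker (Om T) ~> measurableTypeR R)
    (hN : forall T : R, 0 < T -> lam_star * T `^ (- gamma) < 1 ->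
      hawkes_process (P T) (heavy_kernel gamma) (mu_ gamma mu_star T)
        (rho_ gamma lam_star T) (N T))
    (dV : R -> measure_display) (OmV : forall u : R, measurableType (dV u))
    (Q : forall u : R, probability (OmV u) R)
    (V : forall u : R, {RV (Q u) >-> R})
    (hV0 : forall u : R, 0 < u <= 1 -> forall w, 0 <= V u w)
    (hVlaw : {ae lebesgue_measure, forall u : R, 0 < u <= 1 ->
      cvg_in_law P
        (fun T w => lambda_ gamma lam_star mu_star T (N T w) (u * T)
                    / lambda_bar gamma lam_star mu_star T)
        (Q u) (V u)})
    (hVpos : (0 < \int[lebesgue_measure]_(u in `]0%R, 1%R])
                    Q u [set w | V u w = 0%R])%E) :
  [/\ A_ (P T) gamma lam_star mu_star T (N T) @[T --> +oo%R] --> +oo%E,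
      efficient_log_mu (fisher_ (P T) gamma lam_star mu_star T (N T))
        @[T --> +oo%R] --> +oo%R
    & forall T : R, 0 < T -> lam_star * T `^ (- gamma) < 1 ->
      efficient_log_one_minus_rho
        (fisher_ (P T) gamma lam_star mu_star T (N T))
      <= mu_star * lam_star / rho_ gamma lam_star T ^+ 2].
Proof.
have [gamma_half gamma1] := andP hgamma.
have gamma0 : 0 < gamma by apply: lt_trans gamma_half; rewrite invr_gt0.
have gamma01 : 0 < gamma < 1 by rewrite gamma0.
have near_stable : \forall T \near +oo, 0 < T /\ lam_star * T `^ (- gamma) < 1.
  near=> T.
  have T0 : 0 < T by near: T; exact: nbhs_pinfty_gt.
  split => //; rewrite powRN ltr_pdivrMr ?powR_gt0// mul1r.
  apply: (@lt_le_trans _ _ (lam_star + 1)); first by rewrite ltrDl.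
  by near: T; exact: powR_near_ge.
have A_oo : A_ (P T) gamma lam_star mu_star T (N T) @[T --> +oo%R] --> +oo%E.
  apply: (expected_inverse_diverges hVlaw hVpos).
  apply: filterS near_stable => T [T0 stable] e e0.
  exact: (hawkes_damped_le (heavy_kernel_ge0 gamma01) (mu_gt0 gamma hmu T0)
    (rho_gt0 stable) (hN T T0 stable) T0 (lambda_bar_gt0 gamma hlam hmu T0) e0).
split => //; last first.
  move=> T T0 stable.
  exact: (efficient_log_one_minus_rho_le gamma01 hlam hmu T0 stable (hN T T0 stable)).
pose c := mu_star / (2 * (lam_star + 2 / (1 - gamma))).
apply/cvgryPge => M; near=> T.
have [T0 stable] : 0 < T /\ lam_star * T `^ (- gamma) < 1 by near: T.
have T1 : 1 <= T by near: T; apply: nbhs_pinfty_ge; exact: num_real.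
have cT : 4 * mu_star / c <= T `^ gamma by near: T; exact: powR_near_ge.
have loss := information_loss_le gamma01 hlam hmu T0 stable (hN T T0 stable) T1 cT.
rewrite -/c in loss.
have MA : (((M + 2 * mu_star ^+ 2 / c) / (mu_star * lam_star))%:E <=
    A_ (P T) gamma lam_star mu_star T (N T))%E.
  by near: T; move/cvgeyPge : A_oo; exact.
have Afin := A_fin gamma01 hlam hmu T0 stable (hN T T0 stable).
move: MA; rewrite -(fineK Afin) lee_fin ler_pdivrMr ?mulr_gt0// => MA.
rewrite /efficient_log_mu lerBrDr.
rewrite (fisher_log_muE gamma01 hlam hmu T0 stable (hN T T0 stable)) [leRHS]mulrC.
by apply: le_trans MA; rewrite lerD2l.
Unshelve. all: by end_near. Qed.
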